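(* Let $\mathbb{K}$ be a field and let $0\to\mathfrak{r}\to\mathfrak{f}\to\mathfrak{g}\to0$ be a free presentation of a Leibniz algebra $\mathfrak{g}$ over $\mathbb{K}$ (a short exact sequence of Leibniz algebras in which $\mathfrak{f}$ is a free Leibniz algebra over a set). Then there is an isomorphism $$HL_3(\mathfrak{g})\cong\operatorname{Ker}\big(\theta_{\mathfrak{r},\mathfrak{f}}\colon\mathfrak{r}\curlywedge\mathfrak{f}\to\mathfrak{r}\big).$$
   Context: $\mathbb{K}$ is a field; all vector spaces and algebras are over $\mathbb{K}$, and $\otimes=\otimes_{\mathbb{K}}$. A Leibniz algebra is a vector space $\mathfrak{g}$ with a bilinear bracket satisfying $[x,[y,z]]=[[x,y],z]-[[x,z],y]$. Homomorphisms are linear maps preserving the bracket. The free Leibniz algebra on a set $X$ is the value at $X$ of the left adjoint to the forgetful functor from Leibniz algebras to sets. Leibniz homology: $HL_n(\mathfrak{g})$ is the $n$-th homology of the complex $CL_*(\mathfrak{g})$ with $CL_n(\mathfrak{g})=\mathfrak{g}^{\otimes n}$ ($CL_0=\mathbb{K}$), $d(x)=0$ for $x\in\mathfrak{g}$, and for $n>1$ $$d(x_1\otimes\cdots\otimes x_n)=\sum_{1\le i<j\le n}(-1)^j\, x_1\otimes\cdots\otimes x_{i-1}\otimes[x_i,x_j]\otimes x_{i+1}\otimes\cdots\otimes\widehat{x_j}\otimes\cdots\otimes x_n .$$ Non-abelian tensor and exterior product of ideals: let $\mathfrak{a},\mathfrak{b}$ be two-sided ideals of a Leibniz algebra. $\mathfrak{a}\star\mathfrak{b}$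 is the Leibniz algebra generated by two formally distinct families of symbols $a*_1b$ and $b*_2a$ ($a\in\mathfrak{a}$, $b\in\mathfrak{b}$), both $\mathbb{K}$-bilinear in their arguments, subject to, for all $a,a'\in\mathfrak{a}$, $b,b'\in\mathfrak{b}$: $a*_1[b,b']=[a,b]*_1b'-[a,b']*_1b$; $b*_2[a,a']=[b,a]*_2a'-[b,a']*_2a$; $[a,a']*_1b=[a,b]*_2a'-a*_1[b,a']$; $[b,b']*_2a=[b,a]*_1b'-b*_2[a,b']$; $a*_1[a',b]=-a*_1[b,a']$; $b*_2[b',a]=-b*_2[a,b']$; $[a,b]*_1[a',b']=[a*_1b,\,a'*_1b']=[a,b]*_2[a',b']$; $[b,a]*_1[b',a']=[b*_2a,\,b'*_2a']=[b,a]*_2[b',a']$; $[a,b]*_1[b',a']=[a*_1b,\,b'*_2a']=[a,b]*_2[b',a']$; $[b,a]*_1[a',b']=[b*_2a,\,a'*_1b']=[b,a]*_2[a',b']$. The non-abelian exterior product $\mathfrak{a}\curlywedge\mathfrak{b}$ is the quotient of $\mathfrak{a}\star\mathfrak{b}$ by the (central) ideal spanned by all $c*_1c'-c*_2c'$ with $c,c'\in\mathfrak{a}\cap\mathfrak{b}$. The classes of $a*_1b$ and $b*_2a$ are written $a\curlywedge b$ and $b\curlywedge a$. The Leibniz homomorphism $\theta_{\mathfrak{a},\mathfrak{b}}\colon\mathfrak{a}\curlywedge\mathfrak{b}\to\mathfrak{a}\cap\mathfrak{b}$ is given by $a\curlywedge b\mapsto[a,b]$, $b\curlywedge a\mapsto[b,a]$.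 Here $\mathfrak{a}=\mathfrak{r}$ (viewed as an ideal of $\mathfrak{f}$) and $\mathfrak{b}=\mathfrak{f}$. *)

(* Defs.v *)
From HB Require Import structures.
From mathcomp Require Import all_boot all_order all_algebra.
From mathcomp.classical Require Import boolp.

Set Implicit Arguments.
Unset Strict Implicit.
Unset Printing Implicit Defensive.

Import GRing.Theory.
Local Open Scope ring_scope.
Local Open Scope quotient_scope.

Reserved Notation "{[ x , y ]}" (at level 0, x, y at level 99,
  format "{[ x ,  y ]}").
Reserved Notation "{ 'leibniz' U -> V }" (at level 0, U at level 98,
  V at level 99, format "{ 'leibniz'  U  ->  V }").

HB.mixin Record Lmodule_isLeibniz (K : fieldType) L of GRing.Lmodule K L := {
  lbr : L -> L -> L;
  lbr_linearl : forall z a x y, lbr (a *: x + y) z = a *: lbr x z + lbr y z;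
  lbr_linearr : forall z a x y, lbr z (a *: x + y) = a *: lbr z x + lbr z y;
  lbr_leibniz : forall x y z, lbr x (lbr y z) = lbr (lbr x y) z - lbr (lbr x z) y
}.

#[short(type="leibnizType")]
HB.structure Definition Leibniz (K : fieldType) :=
  { L of GRing.Lmodule K L & Lmodule_isLeibniz K L }.

Notation "{[ x , y ]}" := (lbr x y) : ring_scope.

HB.mixin Record isBracketMorphism (K : fieldType) (L M : leibnizType K)
    (f : L -> M) := {
  lbr_morph : forall x y, f {[ x, y ]} = {[ f x, f y ]}
}.

HB.structure Definition LeibnizHom (K : fieldType) (L M : leibnizType K) :=
  { f of @GRing.Linear K L M *:%R f & isBracketMorphism K L M f }.

Notation "{ 'leibniz' U -> V }" := (LeibnizHom.type U V) : type_scope.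

Section LeibnizTheory.
Context {K : fieldType} {L : leibnizType K}.
Implicit Types (a : K) (x y z : L).

Lemma lbrDl z x y : {[ x + y, z ]} = {[ x, z ]} + {[ y, z ]}.
Proof. by have := lbr_linearl z 1 x y; rewrite !scale1r. Qed.
Lemma lbrDr z x y : {[ z, x + y ]} = {[ z, x ]} + {[ z, y ]}.
Proof. by have := lbr_linearr z 1 x y; rewrite !scale1r. Qed.
Lemma lbr0l z : {[ 0 : L, z ]} = 0.
Proof. by apply: (addIr {[ 0 : L, z ]}); rewrite -lbrDl !add0r. Qed.
Lemma lbr0r z : {[ z, 0 : L ]} = 0.
Proof. by apply: (addIr {[ z, 0 : L ]}); rewrite -lbrDr !add0r. Qed.
Lemma lbrZl z a x : {[ a *: x, z ]} = a *: {[ x, z ]}.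
Proof. by have := lbr_linearl z a x 0; rewrite lbr0l !addr0. Qed.
Lemma lbrZr z a x : {[ z, a *: x ]} = a *: {[ z, x ]}.
Proof. by have := lbr_linearr z a x 0; rewrite lbr0r !addr0. Qed.
Lemma lbrNl z x : {[ - x, z ]} = - {[ x, z ]}.
Proof. by rewrite -scaleN1r lbrZl scaleN1r. Qed.
Lemma lbrNr z x : {[ z, - x ]} = - {[ z, x ]}.
Proof. by rewrite -scaleN1r lbrZr scaleN1r. Qed.

End LeibnizTheory.

(* A vector space up to the congruence [pl_eqv], the opposite of [x] being
   [(-1) x]. Tensor powers, quotients by subspaces or ideals, and presented
   algebras are all quotients of such structures. *)
Record prelmod (K : fieldType) := PreLmod {
  pl_car : Type;
  pl_eqv : pl_car -> pl_car -> Prop;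
  pl_zero : pl_car;
  pl_add : pl_car -> pl_car -> pl_car;
  pl_scale : K -> pl_car -> pl_car;
  pl_refl : forall x, pl_eqv x x;
  pl_sym : forall x y, pl_eqv x y -> pl_eqv y x;
  pl_trans : forall x y z, pl_eqv x y -> pl_eqv y z -> pl_eqv x z;
  pl_addE : forall x x' y y', pl_eqv x x' -> pl_eqv y y' ->
    pl_eqv (pl_add x y) (pl_add x' y');
  pl_scaleE : forall a x x', pl_eqv x x' -> pl_eqv (pl_scale a x) (pl_scale a x');
  pl_addA : forall x y z,
    pl_eqv (pl_add x (pl_add y z)) (pl_add (pl_add x y) z);
  pl_addC : forall x y, pl_eqv (pl_add x y) (pl_add y x);
  pl_add0 : forall x, pl_eqv (pl_add pl_zero x) x;
  pl_addN : forall x, pl_eqv (pl_add (pl_scale (-1) x) x) pl_zero;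
  pl_scaleA : forall a b x,
    pl_eqv (pl_scale a (pl_scale b x)) (pl_scale (a * b) x);
  pl_scale1 : forall x, pl_eqv (pl_scale 1 x) x;
  pl_scaleDr : forall a x y,
    pl_eqv (pl_scale a (pl_add x y)) (pl_add (pl_scale a x) (pl_scale a y));
  pl_scaleDl : forall a b x,
    pl_eqv (pl_scale (a + b) x) (pl_add (pl_scale a x) (pl_scale b x))
}.

Section QuotientModule.
Variables (K : fieldType) (P : prelmod K).

Definition pl_eqb : rel {classic pl_car P} := fun x y => `[< @pl_eqv K P x y >].

Lemma pl_eqb_equiv : equiv_class_of pl_eqb.
Proof.
split=> [x|x y|y x z]; first exact/asboolP/pl_refl.
  by apply/asboolP/asboolP; apply: pl_sym.
by move=> /asboolP xy /asboolP yz; apply/asboolP; apply: pl_trans xy yz.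
Qed.

Canonical pl_equiv := EquivRelPack pl_eqb_equiv.

Definition lmod_quot := {eq_quot pl_equiv}.

HB.instance Definition _ := Choice.on lmod_quot.

Definition lmod_pi (x : pl_car P) : lmod_quot := \pi x.
Definition lmod_repr (u : lmod_quot) : pl_car P := repr u.

Lemma lmod_reprK u : lmod_pi (lmod_repr u) = u.
Proof. exact: reprK. Qed.

Lemma lmod_piP x y : lmod_pi x = lmod_pi y <-> pl_eqv x y.
Proof.
split=> [/eqmodP /asboolP //|xy]; exact/eqmodP/asboolP.
Qed.

Lemma lmod_repr_pi x : pl_eqv (lmod_repr (lmod_pi x)) x.
Proof. by apply/lmod_piP; rewrite lmod_reprK. Qed.

Definition lq_add u v := lmod_pi (pl_add (lmod_repr u) (lmod_repr v)).
Definition lq_scale a u := lmod_pi (pl_scale a (lmod_repr u)).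

Lemma lq_addE x y : lq_add (lmod_pi x) (lmod_pi y) = lmod_pi (pl_add x y).
Proof. by apply/lmod_piP/pl_addE; apply: lmod_repr_pi. Qed.
Lemma lq_scaleE a x : lq_scale a (lmod_pi x) = lmod_pi (pl_scale a x).
Proof. by apply/lmod_piP/pl_scaleE; apply: lmod_repr_pi. Qed.

Let lq_ind (Q : lmod_quot -> Prop) : (forall x, Q (lmod_pi x)) -> forall u, Q u.
Proof. by move=> H u; rewrite -[u]lmod_reprK. Qed.

Lemma lq_addA : associative lq_add.
Proof.
elim/lq_ind=> x; elim/lq_ind=> y; elim/lq_ind=> z.
by rewrite !lq_addE; apply/lmod_piP/pl_addA.
Qed.
Lemma lq_addC : commutative lq_add.
Proof.
elim/lq_ind=> x; elim/lq_ind=> y.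
by rewrite !lq_addE; apply/lmod_piP/pl_addC.
Qed.
Lemma lq_add0 : left_id (lmod_pi (pl_zero P)) lq_add.
Proof. by elim/lq_ind=> x; rewrite lq_addE; apply/lmod_piP/pl_add0. Qed.
Lemma lq_addN : left_inverse (lmod_pi (pl_zero P)) (lq_scale (-1)) lq_add.
Proof.
by elim/lq_ind=> x; rewrite lq_scaleE lq_addE; apply/lmod_piP/pl_addN.
Qed.

HB.instance Definition _ :=
  GRing.isZmodule.Build lmod_quot lq_addA lq_addC lq_add0 lq_addN.

Lemma lq_scaleA a b u : lq_scale a (lq_scale b u) = lq_scale (a * b) u.
Proof.
by elim/lq_ind: u => x; rewrite !lq_scaleE; apply/lmod_piP/pl_scaleA.
Qed.
Lemma lq_scale1 : left_id 1 lq_scale.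
Proof. by elim/lq_ind=> x; rewrite lq_scaleE; apply/lmod_piP/pl_scale1. Qed.
Lemma lq_scaleDr : right_distributive lq_scale +%R.
Proof.
move=> a; elim/lq_ind=> x; elim/lq_ind=> y.
rewrite [_ + _ in LHS]lq_addE !lq_scaleE [RHS]lq_addE.
exact/lmod_piP/pl_scaleDr.
Qed.
Lemma lq_scaleDl u : {morph lq_scale^~ u : a b / a + b}.
Proof.
elim/lq_ind: u => x a b; rewrite !lq_scaleE [RHS]lq_addE.
exact/lmod_piP/pl_scaleDl.
Qed.

HB.instance Definition _ := GRing.Zmodule_isLmodule.Build K lmod_quot
  lq_scaleA lq_scale1 lq_scaleDr lq_scaleDl.

Lemma lmod_pi0 : lmod_pi (pl_zero P) = 0. Proof. by []. Qed.
Lemma lmod_piD x y : lmod_pi (pl_add x y) = lmod_pi x + lmod_pi y.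
Proof. by rewrite [RHS]lq_addE. Qed.
Lemma lmod_piZ a x : lmod_pi (pl_scale a x) = a *: lmod_pi x.
Proof. by rewrite [RHS]lq_scaleE. Qed.

Section Lift.
Variables (V : lmodType K) (f : pl_car P -> V).
Hypothesis fE : forall x y, pl_eqv x y -> f x = f y.
Hypothesis fD : forall x y, f (pl_add x y) = f x + f y.
Hypothesis fZ : forall a x, f (pl_scale a x) = a *: f x.

Definition lmod_lift (u : lmod_quot) : V := f (lmod_repr u).

Lemma lmod_liftE x : lmod_lift (lmod_pi x) = f x.
Proof. exact/fE/lmod_repr_pi. Qed.

Lemma lmod_lift_linear : linear lmod_lift.
Proof.
move=> a; elim/lq_ind=> x; elim/lq_ind=> y.
by rewrite -lmod_piZ -lmod_piD !lmod_liftE fD fZ.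
Qed.

End Lift.
End QuotientModule.

Record preleib (K : fieldType) := PreLeib {
  pb_mod :> prelmod K;
  pb_br : pl_car pb_mod -> pl_car pb_mod -> pl_car pb_mod;
  pb_brE : forall x x' y y', pl_eqv x x' -> pl_eqv y y' ->
    pl_eqv (pb_br x y) (pb_br x' y');
  pb_linearl : forall z a x y, pl_eqv (pb_br (pl_add (pl_scale a x) y) z)
    (pl_add (pl_scale a (pb_br x z)) (pb_br y z));
  pb_linearr : forall z a x y, pl_eqv (pb_br z (pl_add (pl_scale a x) y))
    (pl_add (pl_scale a (pb_br z x)) (pb_br z y));
  pb_leibniz : forall x y z, pl_eqv (pb_br x (pb_br y z))
    (pl_add (pb_br (pb_br x y) z) (pl_scale (-1) (pb_br (pb_br x z) y)))
}.

Section QuotientLeibniz.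
Variables (K : fieldType) (P : preleib K).

Definition leib_quot := lmod_quot P.
HB.instance Definition _ := GRing.Lmodule.on leib_quot.

Definition leib_pi (x : pl_car P) : leib_quot := lmod_pi x.

Definition bq_br (u v : leib_quot) : leib_quot :=
  leib_pi (pb_br (lmod_repr u) (lmod_repr v)).

Lemma bq_brE x y : bq_br (leib_pi x) (leib_pi y) = leib_pi (pb_br x y).
Proof. by apply/lmod_piP/pb_brE; apply: lmod_repr_pi. Qed.

Let bq_ind (Q : leib_quot -> Prop) : (forall x, Q (leib_pi x)) -> forall u, Q u.
Proof. by move=> H u; rewrite -[u]lmod_reprK. Qed.
Let piD x y : leib_pi (pl_add x y) = leib_pi x + leib_pi y.
Proof. exact: lmod_piD. Qed.
Let piZ a x : leib_pi (pl_scale a x) = a *: leib_pi x.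
Proof. exact: lmod_piZ. Qed.

Lemma bq_linearl z a x y : bq_br (a *: x + y) z = a *: bq_br x z + bq_br y z.
Proof.
elim/bq_ind: x => x; elim/bq_ind: y => y; elim/bq_ind: z => z.
rewrite -piZ -piD !bq_brE -piZ -piD; exact/lmod_piP/pb_linearl.
Qed.
Lemma bq_linearr z a x y : bq_br z (a *: x + y) = a *: bq_br z x + bq_br z y.
Proof.
elim/bq_ind: x => x; elim/bq_ind: y => y; elim/bq_ind: z => z.
rewrite -piZ -piD !bq_brE -piZ -piD; exact/lmod_piP/pb_linearr.
Qed.
Lemma bq_leibniz x y z :
  bq_br x (bq_br y z) = bq_br (bq_br x y) z - bq_br (bq_br x z) y.
Proof.
elim/bq_ind: x => x; elim/bq_ind: y => y; elim/bq_ind: z => z.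
rewrite !bq_brE -scaleN1r -piZ -piD; exact/lmod_piP/pb_leibniz.
Qed.

HB.instance Definition _ :=
  Lmodule_isLeibniz.Build K leib_quot bq_linearl bq_linearr bq_leibniz.

Lemma leib_piB x y : leib_pi (pb_br x y) = {[ leib_pi x, leib_pi y ]}.
Proof. by rewrite [RHS]bq_brE. Qed.

Section Lift.
Variables (M : leibnizType K) (f : pl_car P -> M).
Hypothesis fE : forall x y, pl_eqv x y -> f x = f y.
Hypothesis fD : forall x y, f (pl_add x y) = f x + f y.
Hypothesis fZ : forall a x, f (pl_scale a x) = a *: f x.
Hypothesis fB : forall x y, f (pb_br x y) = {[ f x, f y ]}.

Definition leib_lift (u : leib_quot) : M := lmod_lift f u.

Lemma leib_liftE x : leib_lift (leib_pi x) = f x.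
Proof. exact: lmod_liftE. Qed.

Lemma leib_lift_linear : linear leib_lift.
Proof. exact: lmod_lift_linear. Qed.

Lemma leib_lift_br x y : leib_lift {[ x, y ]} = {[ leib_lift x, leib_lift y ]}.
Proof.
elim/bq_ind: x => x; elim/bq_ind: y => y.
by rewrite -leib_piB !leib_liftE fB.
Qed.

End Lift.
End QuotientLeibniz.

(* [R s t] is read as the relation [s = t]. *)
Inductive lmod_term (K G : Type) : Type :=
  | MGen of G
  | MZero
  | MAdd of lmod_term K G & lmod_term K G
  | MScale of K & lmod_term K G.
Arguments MGen {K G}.
Arguments MZero {K G}.

Inductive lmod_cong (K : fieldType) (G : Type)
    (R : lmod_term K G -> lmod_term K G -> Prop) :
    lmod_term K G -> lmod_term K G -> Prop :=
  | MC_rel s t : R s t -> lmod_cong R s t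
  | MC_refl s : lmod_cong R s s
  | MC_sym s t : lmod_cong R s t -> lmod_cong R t s
  | MC_trans s t u : lmod_cong R s t -> lmod_cong R t u -> lmod_cong R s u
  | MC_addE s s' t t' : lmod_cong R s s' -> lmod_cong R t t' ->
      lmod_cong R (MAdd s t) (MAdd s' t')
  | MC_scaleE a s s' : lmod_cong R s s' ->
      lmod_cong R (MScale a s) (MScale a s')
  | MC_addA s t u : lmod_cong R (MAdd s (MAdd t u)) (MAdd (MAdd s t) u)
  | MC_addC s t : lmod_cong R (MAdd s t) (MAdd t s)
  | MC_add0 s : lmod_cong R (MAdd MZero s) s
  | MC_addN s : lmod_cong R (MAdd (MScale (-1) s) s) MZero
  | MC_scaleA a b s : lmod_cong R (MScale a (MScale b s)) (MScale (a * b) s)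
  | MC_scale1 s : lmod_cong R (MScale 1 s) s
  | MC_scaleDr a s t :
      lmod_cong R (MScale a (MAdd s t)) (MAdd (MScale a s) (MScale a t))
  | MC_scaleDl a b s :
      lmod_cong R (MScale (a + b) s) (MAdd (MScale a s) (MScale b s)).

Section PresentedModule.
Variables (K : fieldType) (G : Type) (R : lmod_term K G -> lmod_term K G -> Prop).

Definition lmod_pres_pre : prelmod K := @PreLmod K (lmod_term K G)
  (lmod_cong R) MZero (@MAdd K G) (@MScale K G)
  (@MC_refl K G R) (@MC_sym K G R) (@MC_trans K G R) (@MC_addE K G R)
  (@MC_scaleE K G R) (@MC_addA K G R) (@MC_addC K G R) (@MC_add0 K G R)
  (@MC_addN K G R) (@MC_scaleA K G R) (@MC_scale1 K G R) (@MC_scaleDr K G R)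
  (@MC_scaleDl K G R).

Definition lmod_pres := lmod_quot lmod_pres_pre.
HB.instance Definition _ := GRing.Lmodule.on lmod_pres.

Definition lmod_gen (x : G) : lmod_pres := lmod_pi (P := lmod_pres_pre) (MGen x).

Section Eval.
Variables (V : lmodType K) (j : G -> V).

Fixpoint lmod_eval (s : lmod_term K G) : V :=
  match s with
  | MGen x => j x
  | MZero => 0
  | MAdd s t => lmod_eval s + lmod_eval t
  | MScale a s => a *: lmod_eval s
  end.

Hypothesis jR : forall s t, R s t -> lmod_eval s = lmod_eval t.

Lemma lmod_eval_cong s t : lmod_cong R s t -> lmod_eval s = lmod_eval t.
Proof.
elim=> {s t} //=.
- by move=> s t u _ -> _ ->.
- by move=> s s' t t' _ -> _ ->.
- by move=> a s s' _ ->.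
- by move=> s t u; rewrite addrA.
- by move=> s t; rewrite addrC.
- by move=> s; rewrite add0r.
- by move=> s; rewrite scaleN1r addNr.
- by move=> a b s; rewrite scalerA.
- by move=> s; rewrite scale1r.
- by move=> a s t; rewrite scalerDr.
- by move=> a b s; rewrite scalerDl.
Qed.

Definition lmod_pres_lift : lmod_pres -> V :=
  lmod_lift (P := lmod_pres_pre) lmod_eval.

Lemma lmod_pres_liftE x : lmod_pres_lift (lmod_gen x) = j x.
Proof. exact: (lmod_liftE (P := lmod_pres_pre) lmod_eval_cong). Qed.

Lemma lmod_pres_lift_linear : linear lmod_pres_lift.
Proof. exact: (lmod_lift_linear (P := lmod_pres_pre) lmod_eval_cong). Qed.

End Eval.

Lemma lmod_eval_gen s :
  lmod_eval lmod_gen s = lmod_pi (P := lmod_pres_pre) s :> lmod_pres.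
Proof.
elim: s => //= [s -> t ->|a s ->].
  by symmetry; apply: (lmod_piD (P := lmod_pres_pre)).
by symmetry; apply: (lmod_piZ (P := lmod_pres_pre)).
Qed.

Lemma lmod_pres_rel s t : R s t -> lmod_eval lmod_gen s = lmod_eval lmod_gen t.
Proof.
by move=> Rst; rewrite !lmod_eval_gen; apply/lmod_piP; apply: MC_rel.
Qed.

End PresentedModule.

Inductive leib_term (K G : Type) : Type :=
  | LGen of G
  | LZero
  | LAdd of leib_term K G & leib_term K G
  | LScale of K & leib_term K G
  | LBr of leib_term K G & leib_term K G.
Arguments LGen {K G}.
Arguments LZero {K G}.

Inductive leib_cong (K : fieldType) (G : Type)
    (R : leib_term K G -> leib_term K G -> Prop) :
    leib_term K G -> leib_term K G -> Prop :=
  | LC_rel s t : R s t -> leib_cong R s t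
  | LC_refl s : leib_cong R s s
  | LC_sym s t : leib_cong R s t -> leib_cong R t s
  | LC_trans s t u : leib_cong R s t -> leib_cong R t u -> leib_cong R s u
  | LC_addE s s' t t' : leib_cong R s s' -> leib_cong R t t' ->
      leib_cong R (LAdd s t) (LAdd s' t')
  | LC_scaleE a s s' : leib_cong R s s' ->
      leib_cong R (LScale a s) (LScale a s')
  | LC_addA s t u : leib_cong R (LAdd s (LAdd t u)) (LAdd (LAdd s t) u)
  | LC_addC s t : leib_cong R (LAdd s t) (LAdd t s)
  | LC_add0 s : leib_cong R (LAdd LZero s) s
  | LC_addN s : leib_cong R (LAdd (LScale (-1) s) s) LZero
  | LC_scaleA a b s : leib_cong R (LScale a (LScale b s)) (LScale (a * b) s)
  | LC_scale1 s : leib_cong R (LScale 1 s) s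
  | LC_scaleDr a s t :
      leib_cong R (LScale a (LAdd s t)) (LAdd (LScale a s) (LScale a t))
  | LC_scaleDl a b s :
      leib_cong R (LScale (a + b) s) (LAdd (LScale a s) (LScale b s))
  | LC_brE s s' t t' : leib_cong R s s' -> leib_cong R t t' ->
      leib_cong R (LBr s t) (LBr s' t')
  | LC_linearl u a s t : leib_cong R (LBr (LAdd (LScale a s) t) u)
      (LAdd (LScale a (LBr s u)) (LBr t u))
  | LC_linearr u a s t : leib_cong R (LBr u (LAdd (LScale a s) t))
      (LAdd (LScale a (LBr u s)) (LBr u t))
  | LC_leibniz s t u : leib_cong R (LBr s (LBr t u))
      (LAdd (LBr (LBr s t) u) (LScale (-1) (LBr (LBr s u) t))).

Section PresentedLeibniz.
Variables (K : fieldType) (G : Type) (R : leib_term K G -> leib_term K G -> Prop).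

Definition leib_pres_premod : prelmod K := @PreLmod K (leib_term K G)
  (leib_cong R) LZero (@LAdd K G) (@LScale K G)
  (@LC_refl K G R) (@LC_sym K G R) (@LC_trans K G R) (@LC_addE K G R)
  (@LC_scaleE K G R) (@LC_addA K G R) (@LC_addC K G R) (@LC_add0 K G R)
  (@LC_addN K G R) (@LC_scaleA K G R) (@LC_scale1 K G R) (@LC_scaleDr K G R)
  (@LC_scaleDl K G R).

Definition leib_pres_pre : preleib K := @PreLeib K leib_pres_premod (@LBr K G)
  (@LC_brE K G R) (@LC_linearl K G R) (@LC_linearr K G R) (@LC_leibniz K G R).

Definition leib_pres := leib_quot leib_pres_pre.
HB.instance Definition _ := Leibniz.on leib_pres.

Definition leib_gen (x : G) : leib_pres := leib_pi (P := leib_pres_pre) (LGen x).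

Section Eval.
Variables (M : leibnizType K) (j : G -> M).

Fixpoint leib_eval (s : leib_term K G) : M :=
  match s with
  | LGen x => j x
  | LZero => 0
  | LAdd s t => leib_eval s + leib_eval t
  | LScale a s => a *: leib_eval s
  | LBr s t => {[ leib_eval s, leib_eval t ]}
  end.

Hypothesis jR : forall s t, R s t -> leib_eval s = leib_eval t.

Lemma leib_eval_cong s t : leib_cong R s t -> leib_eval s = leib_eval t.
Proof.
elim=> {s t} //=.
- by move=> s t u _ -> _ ->.
- by move=> s s' t t' _ -> _ ->.
- by move=> a s s' _ ->.
- by move=> s t u; rewrite addrA.
- by move=> s t; rewrite addrC.
- by move=> s; rewrite add0r.
- by move=> s; rewrite scaleN1r addNr.
- by move=> a b s; rewrite scalerA.
- by move=> s; rewrite scale1r.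
- by move=> a s t; rewrite scalerDr.
- by move=> a b s; rewrite scalerDl.
- by move=> s s' t t' _ -> _ ->.
- by move=> u a s t; rewrite lbr_linearl.
- by move=> u a s t; rewrite lbr_linearr.
- by move=> s t u; rewrite lbr_leibniz scaleN1r.
Qed.

Definition leib_pres_lift : leib_pres -> M :=
  leib_lift (P := leib_pres_pre) leib_eval.

Lemma leib_pres_liftE x : leib_pres_lift (leib_gen x) = j x.
Proof. exact: (leib_liftE (P := leib_pres_pre) leib_eval_cong). Qed.

Lemma leib_pres_lift_linear : linear leib_pres_lift.
Proof. exact: (leib_lift_linear (P := leib_pres_pre) leib_eval_cong). Qed.

Lemma leib_pres_lift_br x y :
  leib_pres_lift {[ x, y ]} = {[ leib_pres_lift x, leib_pres_lift y ]}.
Proof. exact: (leib_lift_br (P := leib_pres_pre) leib_eval_cong). Qed.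

End Eval.

Lemma leib_eval_gen s :
  leib_eval leib_gen s = leib_pi (P := leib_pres_pre) s :> leib_pres.
Proof.
elim: s => //= [s -> t ->|a s ->|s -> t ->].
- by symmetry; apply: (lmod_piD (P := leib_pres_pre)).
- by symmetry; apply: (lmod_piZ (P := leib_pres_pre)).
- by symmetry; apply: (leib_piB (P := leib_pres_pre)).
Qed.

Lemma leib_pres_rel s t : R s t -> leib_eval leib_gen s = leib_eval leib_gen t.
Proof.
by move=> Rst; rewrite !leib_eval_gen; apply/lmod_piP; apply: LC_rel.
Qed.

End PresentedLeibniz.

Section Kernel.
Variables (K : fieldType) (U V : lmodType K) (f : {linear U -> V}).

Definition ker_pred : {pred U} := [pred x | f x == 0].

Lemma ker_submod_closed : submod_closed ker_pred.
Proof.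
split=> [|a x y]; rewrite !inE ?linear0 // => /eqP fx /eqP fy.
by rewrite linearP fx fy scaler0 addr0.
Qed.
HB.instance Definition _ := GRing.isSubmodClosed.Build K U ker_pred
  ker_submod_closed.

Record ker := Ker { ker_val :> U; _ : ker_val \in ker_pred }.
HB.instance Definition _ := [isSub for ker_val].
HB.instance Definition _ := [Choice of ker by <:].
HB.instance Definition _ := [SubChoice_isSubLmodule of ker by <:].

End Kernel.

Section QuotientBySubspace.
Variables (K : fieldType) (V : lmodType K) (W : submodClosed V).

Definition eqmodW (x y : V) : Prop := x - y \in W.

Lemma eqmodW_eq x y : x = y -> eqmodW x y.
Proof. by move=> ->; rewrite /eqmodW subrr rpred0. Qed.
Lemma eqmodW_refl x : eqmodW x x.
Proof. exact: eqmodW_eq. Qed.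
Lemma eqmodW_sym x y : eqmodW x y -> eqmodW y x.
Proof. by rewrite /eqmodW => xy; rewrite -(opprB x y) -(scaleN1r (x - y)) rpredZ. Qed.
Lemma eqmodW_trans x y z : eqmodW x y -> eqmodW y z -> eqmodW x z.
Proof. by rewrite /eqmodW => xy yz; rewrite -(subrK y x) -addrA rpredD. Qed.
Lemma eqmodW_addE x x' y y' :
  eqmodW x x' -> eqmodW y y' -> eqmodW (x + y) (x' + y').
Proof. by rewrite /eqmodW => xx yy; rewrite opprD addrACA rpredD. Qed.
Lemma eqmodW_scaleE (a : K) x x' : eqmodW x x' -> eqmodW (a *: x) (a *: x').
Proof. by rewrite /eqmodW => xx; rewrite -scalerBr rpredZ. Qed.
Lemma eqmodW_addN x : eqmodW ((-1 : K) *: x + x) 0.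
Proof. by apply: eqmodW_eq; rewrite scaleN1r addNr. Qed.

Definition quot_premod : prelmod K := @PreLmod K V eqmodW 0 +%R *:%R
  eqmodW_refl eqmodW_sym eqmodW_trans eqmodW_addE eqmodW_scaleE
  (fun x y z => eqmodW_eq (addrA x y z)) (fun x y => eqmodW_eq (addrC x y))
  (fun x => eqmodW_eq (add0r x)) eqmodW_addN
  (fun a b x => eqmodW_eq (scalerA a b x)) (fun x => eqmodW_eq (scale1r x))
  (fun a x y => eqmodW_eq (scalerDr a x y))
  (fun a b x => eqmodW_eq (scalerDl x a b)).

Definition quot := lmod_quot quot_premod.
HB.instance Definition _ := GRing.Lmodule.on quot.

Definition quot_pi (x : V) : quot := lmod_pi (P := quot_premod) x.

End QuotientBySubspace.

Record ideal (K : fieldType) (L : leibnizType K) := Ideal {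
  ideal_pred :> {pred L};
  ideal_submod : submod_closed ideal_pred;
  ideal_lbrl : forall x a, a \in ideal_pred -> {[ x, a ]} \in ideal_pred;
  ideal_lbrr : forall a x, a \in ideal_pred -> {[ a, x ]} \in ideal_pred
}.

HB.instance Definition _ (K : fieldType) (L : leibnizType K) (I : ideal L) :=
  GRing.isSubmodClosed.Build K L (ideal_pred I) (ideal_submod I).

Section IdealAlgebra.
Variables (K : fieldType) (L : leibnizType K) (I : ideal L).

Record ideal_alg := IdealAlg { ideal_val :> L; _ : ideal_val \in ideal_pred I }.
HB.instance Definition _ := [isSub for ideal_val].
HB.instance Definition _ := [Choice of ideal_alg by <:].
HB.instance Definition _ := [SubChoice_isSubLmodule of ideal_alg by <:].

Implicit Types (a b : ideal_alg) (x : L).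

Lemma ideal_valP a : ideal_val a \in ideal_pred I.
Proof. exact: valP a. Qed.

(* [x, a] and [a, x], as elements of the ideal. *)
Definition lact x a : ideal_alg := IdealAlg (ideal_lbrl x (ideal_valP a)).
Definition ract a x : ideal_alg := IdealAlg (ideal_lbrr x (ideal_valP a)).

Definition ideal_br a b := lact (ideal_val a) b.

Lemma ideal_val_inj : injective ideal_val.
Proof. exact: val_inj. Qed.
Lemma ideal_val0 : ideal_val 0 = 0. Proof. exact: (raddf0 \val). Qed.
Lemma ideal_valD a b : ideal_val (a + b) = ideal_val a + ideal_val b.
Proof. exact: (raddfD \val). Qed.
Lemma ideal_valN a : ideal_val (- a) = - ideal_val a.
Proof. exact: (raddfN \val). Qed.
Lemma ideal_valZ (c : K) a : ideal_val (c *: a) = c *: ideal_val a.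
Proof. exact: GRing.valZ. Qed.

Let br_val a b : ideal_val (ideal_br a b) = {[ ideal_val a, ideal_val b ]}.
Proof. by []. Qed.

Lemma ideal_br_linearl z (c : K) a b :
  ideal_br (c *: a + b) z = c *: ideal_br a z + ideal_br b z.
Proof.
by apply: ideal_val_inj; rewrite !(br_val, ideal_valD, ideal_valZ) lbr_linearl.
Qed.
Lemma ideal_br_linearr z (c : K) a b :
  ideal_br z (c *: a + b) = c *: ideal_br z a + ideal_br z b.
Proof.
by apply: ideal_val_inj; rewrite !(br_val, ideal_valD, ideal_valZ) lbr_linearr.
Qed.
Lemma ideal_br_leibniz a b c :
  ideal_br a (ideal_br b c) =
    ideal_br (ideal_br a b) c - ideal_br (ideal_br a c) b.
Proof.
by apply: ideal_val_inj; rewrite ideal_valD ideal_valN !br_val lbr_leibniz.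
Qed.
HB.instance Definition _ := Lmodule_isLeibniz.Build K ideal_alg
  ideal_br_linearl ideal_br_linearr ideal_br_leibniz.

Lemma ideal_val_br a b : ideal_val {[ a, b ]} = {[ ideal_val a, ideal_val b ]}.
Proof. by []. Qed.

End IdealAlgebra.

Section IdealConstructions.
Variables (K : fieldType) (L : leibnizType K).

Lemma full_ideal_submod : submod_closed (predT : {pred L}).
Proof. by []. Qed.
Definition full_ideal : ideal L :=
  @Ideal K L predT full_ideal_submod (fun _ _ _ => isT) (fun _ _ _ => isT).

Section Cap.
Variables A B : ideal L.
Definition capI_pred : {pred L} := [pred x | (x \in A) && (x \in B)].
Lemma capI_submod : submod_closed capI_pred.
Proof.
split=> [|a x y]; rewrite !inE ?rpred0 // => /andP[xA xB] /andP[yA yB].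
by rewrite !rpredD ?rpredZ.
Qed.
Lemma capI_lbrl x a : a \in capI_pred -> {[ x, a ]} \in capI_pred.
Proof. by rewrite !inE => /andP[aA aB]; rewrite !ideal_lbrl. Qed.
Lemma capI_lbrr a x : a \in capI_pred -> {[ a, x ]} \in capI_pred.
Proof. by rewrite !inE => /andP[aA aB]; rewrite !ideal_lbrr. Qed.
Definition capI : ideal L := Ideal capI_submod capI_lbrl capI_lbrr.
End Cap.

Section Generated.
Variable S : L -> Prop.
Definition genI_pred : {pred L} :=
  [pred x | `[< forall I : ideal L, (forall y, S y -> y \in I) -> x \in I >]].
Lemma genI_submod : submod_closed genI_pred.
Proof.
split=> [|a x y]; rewrite !inE.
  by apply/asboolP => I _; apply: rpred0.
move=> /asboolP xS /asboolP yS; apply/asboolP => I SI.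
by rewrite rpredD ?rpredZ // ?xS ?yS.
Qed.
Lemma genI_lbrl x a : a \in genI_pred -> {[ x, a ]} \in genI_pred.
Proof.
rewrite !inE => /asboolP aS; apply/asboolP => I SI.
by apply: ideal_lbrl; apply: aS.
Qed.
Lemma genI_lbrr a x : a \in genI_pred -> {[ a, x ]} \in genI_pred.
Proof.
rewrite !inE => /asboolP aS; apply/asboolP => I SI.
by apply: ideal_lbrr; apply: aS.
Qed.
Definition genI : ideal L := Ideal genI_submod genI_lbrl genI_lbrr.

Lemma genI_sub x : S x -> x \in genI.
Proof. by move=> Sx; rewrite inE; apply/asboolP => I; apply. Qed.

Lemma genI_min (I : ideal L) :
  (forall y, S y -> y \in I) -> forall x, x \in genI -> x \in I.
Proof. by move=> SI x; rewrite inE => /asboolP; apply. Qed.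
End Generated.

Section KerIdeal.
Variables (M : leibnizType K) (f : L -> M).
Hypotheses (f_lin : linear f) (f_br : forall x y, f {[ x, y ]} = {[ f x, f y ]}).
Definition kerI_pred : {pred L} := [pred x | f x == 0].
Lemma kerI_submod : submod_closed kerI_pred.
Proof.
have f0 : f 0 = 0.
  by have := f_lin (-1) 0 0; rewrite scaler0 addr0 scaleN1r addNr.
split=> [|a x y]; rewrite !inE ?f0 // => /eqP fx /eqP fy.
by rewrite f_lin fx fy scaler0 addr0.
Qed.
Lemma kerI_lbrl x a : a \in kerI_pred -> {[ x, a ]} \in kerI_pred.
Proof. by rewrite !inE f_br => /eqP ->; rewrite lbr0r. Qed.
Lemma kerI_lbrr a x : a \in kerI_pred -> {[ a, x ]} \in kerI_pred.
Proof. by rewrite !inE f_br => /eqP ->; rewrite lbr0l. Qed.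
Definition kerI : ideal L := Ideal kerI_submod kerI_lbrl kerI_lbrr.
End KerIdeal.

Section QuotientByIdeal.
Variable I : ideal L.

Lemma quotI_brE x x' y y' : eqmodW I x x' -> eqmodW I y y' ->
  eqmodW I {[ x, y ]} {[ x', y' ]}.
Proof.
rewrite /eqmodW => xx yy.
have -> : {[ x, y ]} - {[ x', y' ]} = {[ x - x', y ]} + {[ x', y - y' ]}.
  by rewrite lbrDl lbrDr lbrNl lbrNr addrA subrK.
by apply: rpredD; [apply: ideal_lbrr | apply: ideal_lbrl].
Qed.
Lemma quotI_leibniz x y z : eqmodW I {[ x, {[ y, z ]} ]}
  ({[ {[ x, y ]}, z ]} + (-1 : K) *: {[ {[ x, z ]}, y ]}).
Proof. by apply: eqmodW_eq; rewrite scaleN1r lbr_leibniz. Qed.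

Definition quotI_pre : preleib K := @PreLeib K (quot_premod I) lbr quotI_brE
  (fun z a x y => eqmodW_eq I (lbr_linearl z a x y))
  (fun z a x y => eqmodW_eq I (lbr_linearr z a x y)) quotI_leibniz.

Definition quotI := leib_quot quotI_pre.
HB.instance Definition _ := Leibniz.on quotI.

Definition quotI_pi (x : L) : quotI := leib_pi (P := quotI_pre) x.

Section Lift.
Variables (M : leibnizType K) (f : L -> M).
Hypotheses (f_lin : linear f) (f_br : forall x y, f {[ x, y ]} = {[ f x, f y ]}).
Hypothesis fI : forall x, x \in I -> f x = 0.

Lemma quotI_liftD x y : f (x + y) = f x + f y.
Proof. by have := f_lin 1 x y; rewrite !scale1r. Qed.
Lemma quotI_liftZ a x : f (a *: x) = a *: f x.
Proof. by have := f_lin a x 0; rewrite (fI (rpred0 I)) !addr0. Qed.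
Lemma quotI_lift_eqmod x y : eqmodW I x y -> f x = f y.
Proof.
by move=> /fI; rewrite -scaleN1r quotI_liftD quotI_liftZ scaleN1r => /subr0_eq.
Qed.

Definition quotI_lift : quotI -> M := leib_lift (P := quotI_pre) f.

Lemma quotI_liftE x : quotI_lift (quotI_pi x) = f x.
Proof. exact: (leib_liftE (P := quotI_pre) quotI_lift_eqmod). Qed.
Lemma quotI_lift_linear : linear quotI_lift.
Proof.
exact: (leib_lift_linear (P := quotI_pre) quotI_lift_eqmod
  quotI_liftD quotI_liftZ).
Qed.
Lemma quotI_lift_br x y :
  quotI_lift {[ x, y ]} = {[ quotI_lift x, quotI_lift y ]}.
Proof. exact: (leib_lift_br (P := quotI_pre) quotI_lift_eqmod). Qed.
End Lift.
End QuotientByIdeal.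
End IdealConstructions.

Section LeibnizHomology.
Variables (K : fieldType) (L : leibnizType K).

Definition upd n (x : {ffun 'I_n -> L}) (p : 'I_n) (u : L) : {ffun 'I_n -> L} :=
  [ffun k => if k == p then u else x k].

Inductive tensor_rel n :
    lmod_term K {ffun 'I_n -> L} -> lmod_term K {ffun 'I_n -> L} -> Prop :=
  TensorRel x p a u v : tensor_rel (MGen (upd x p (a *: u + v)))
    (MAdd (MScale a (MGen (upd x p u))) (MGen (upd x p v))).

(* The n-th tensor power of [L]: families of [n] vectors, modulo
   multilinearity. *)
Definition CL n := lmod_pres (@tensor_rel n).
HB.instance Definition _ n := GRing.Lmodule.on (CL n).

Definition tens n (x : {ffun 'I_n -> L}) : CL n := lmod_gen (@tensor_rel n) x.

Lemma tens_linear n (x y z : {ffun 'I_n -> L}) p a :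
  x p = a *: y p + z p -> (forall k, k != p -> x k = y k) ->
  (forall k, k != p -> x k = z k) -> tens x = a *: tens y + tens z.
Proof.
move=> xp xy xz.
have Ex : x = upd x p (a *: y p + z p).
  by apply/ffunP => k; rewrite ffunE; case: eqP => // ->.
have Ey : y = upd x p (y p).
  by apply/ffunP => k; rewrite ffunE; case: eqVneq => [->//|/xy].
have Ez : z = upd x p (z p).
  by apply/ffunP => k; rewrite ffunE; case: eqVneq => [->//|/xz].
rewrite [in LHS]Ex [in tens y]Ey [in tens z]Ez.
exact: lmod_pres_rel (TensorRel x p a (y p) (z p)).
Qed.

(* The family [x] with [x i] replaced by [[x i, x j]] and [x j] deleted. *)
Definition contract n (x : {ffun 'I_n -> L}) (i j : 'I_n) : {ffun 'I_n.-1 -> L} :=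
  [ffun k => if lift j k == i then {[ x i, x j ]} else x (lift j k)].

(* Indices start from 0, hence the exponent [j.+1]. *)
Definition bnd_gen n (x : {ffun 'I_n -> L}) : CL n.-1 :=
  \sum_(i < n) \sum_(j < n | (i < j)%N) (-1) ^+ j.+1 *: tens (contract x i j).

Lemma contract_linear n x (p : 'I_n) a u v (i j : 'I_n) : (i < j)%N ->
  tens (contract (upd x p (a *: u + v)) i j) =
    a *: tens (contract (upd x p u) i j) + tens (contract (upd x p v) i j).
Proof.
move=> ij; have neq_ji : j != i by rewrite neq_ltn ij orbT.
have nji := negbTE neq_ji; have nij : (i == j) = false by rewrite eq_sym nji.
have [q qE] : exists q, lift j q = if p == j then i else p.
  case: (eqVneq p j) => [_|pj].
    by case: (unlift_some neq_ji) => q -> _; exists q.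
  rewrite eq_sym in pj.
  by case: (unlift_some pj) => q -> _; exists q.
apply: (@tens_linear _ _ _ _ q).
  rewrite !ffunE qE; case: (eqVneq p j) => [->|pj].
    by rewrite !eqxx nij lbr_linearr.
  by rewrite eqxx; case: (eqVneq p i) => // _; rewrite lbr_linearl.
all: move=> k kq; rewrite !ffunE.
all: have : lift j k != (if p == j then i else p) by
  rewrite -qE (inj_eq lift_inj).
all: case: (eqVneq p j) => [->|pj] kp.
all: rewrite ?(negbTE kp) // 1?eq_sym ?(negbTE (neq_lift _ _)) //.
all: by case: eqP => // ki; rewrite ki (negbTE kp).
Qed.

Lemma bnd_gen_rel n s t : tensor_rel s t ->
  lmod_eval (@bnd_gen n) s = lmod_eval (@bnd_gen n) t.
Proof.
case=> x p a u v /=; rewrite /bnd_gen scaler_sumr -big_split /=.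
apply: eq_bigr => i _; rewrite scaler_sumr -big_split /=.
apply: eq_bigr => j ij; rewrite contract_linear // scalerDr !scalerA.
by rewrite mulrC.
Qed.

(* The differential CL_n -> CL_(n-1). On CL_0 and CL_1 it is zero, the sum
   defining [bnd_gen] being empty. *)
Definition bnd n : CL n -> CL n.-1 :=
  lmod_pres_lift (R := @tensor_rel n) (@bnd_gen n).

Lemma bndE n x : bnd (@tens n x) = bnd_gen x.
Proof. exact: (lmod_pres_liftE (@bnd_gen_rel n)). Qed.
Lemma bnd_linear n : linear (@bnd n).
Proof. exact: (lmod_pres_lift_linear (@bnd_gen_rel n)). Qed.
HB.instance Definition _ n :=
  GRing.isLinear.Build K (CL n) (CL n.-1) *:%R (@bnd n) (@bnd_linear n).

Definition cycles n := ker (@bnd n).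
HB.instance Definition _ n := GRing.Lmodule.on (cycles n).

Definition boundaries n : {pred cycles n} :=
  [pred z | `[< exists y : CL n.+1, bnd y = ker_val z >]].

Lemma boundaries_submod n : submod_closed (@boundaries n).
Proof.
split=> [|a x y]; rewrite !inE.
  by apply/asboolP; exists 0; rewrite linear0.
move=> /asboolP[x' ex] /asboolP[y' ey]; apply/asboolP.
by exists (a *: x' + y'); rewrite bnd_linear ex ey.
Qed.
HB.instance Definition _ n :=
  GRing.isSubmodClosed.Build K (cycles n) (@boundaries n) (@boundaries_submod n).

Definition HL n := quot (@boundaries n).
HB.instance Definition _ n := GRing.Lmodule.on (HL n).

End LeibnizHomology.

Definition LSub (K : fieldType) G (s t : leib_term K G) : leib_term K G :=
  LAdd s (LScale (-1) t).
Definition LOpp (K : fieldType) G (s : leib_term K G) : leib_term K G :=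
  LScale (-1) s.

Section ExteriorProduct.
Variables (K : fieldType) (L : leibnizType K) (A B : ideal L).

Let IA := ideal_alg A.
Let IB := ideal_alg B.

(* [inl (a, b)] and [inr (b, a)] are the symbols a *_1 b and b *_2 a. *)
Definition star_symb : Type := (IA * IB) + (IB * IA).

Let s1 (a : IA) (b : IB) : leib_term K star_symb := LGen (inl (a, b)).
Let s2 (b : IB) (a : IA) : leib_term K star_symb := LGen (inr (b, a)).

(* [a, b] and [b, a] lie in both ideals. *)
Let abA (a : IA) (b : IB) : IA := ract a (ideal_val b).
Let abB (a : IA) (b : IB) : IB := lact (ideal_val a) b.
Let baA (b : IB) (a : IA) : IA := lact (ideal_val b) a.
Let baB (b : IB) (a : IA) : IB := ract b (ideal_val a).

Inductive star_rel : leib_term K star_symb -> leib_term K star_symb -> Prop :=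
  | SR_lin1l k a a' b :
      star_rel (s1 (k *: a + a') b) (LAdd (LScale k (s1 a b)) (s1 a' b))
  | SR_lin1r k a b b' :
      star_rel (s1 a (k *: b + b')) (LAdd (LScale k (s1 a b)) (s1 a b'))
  | SR_lin2l k b b' a :
      star_rel (s2 (k *: b + b') a) (LAdd (LScale k (s2 b a)) (s2 b' a))
  | SR_lin2r k b a a' :
      star_rel (s2 b (k *: a + a')) (LAdd (LScale k (s2 b a)) (s2 b a'))
  | SR_1a a b b' :
      star_rel (s1 a {[ b, b' ]}) (LSub (s1 (abA a b) b') (s1 (abA a b') b))
  | SR_1b b a a' :
      star_rel (s2 b {[ a, a' ]}) (LSub (s2 (baB b a) a') (s2 (baB b a') a))
  | SR_2a a a' b :
      star_rel (s1 {[ a, a' ]} b) (LSub (s2 (abB a b) a') (s1 a (baB b a')))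
  | SR_2b b b' a :
      star_rel (s2 {[ b, b' ]} a) (LSub (s1 (baA b a) b') (s2 b (abA a b')))
  | SR_3a a a' b : star_rel (s1 a (abB a' b)) (LOpp (s1 a (baB b a')))
  | SR_3b b b' a : star_rel (s2 b (baA b' a)) (LOpp (s2 b (abA a b')))
  | SR_4a a b a' b' :
      star_rel (s1 (abA a b) (abB a' b')) (LBr (s1 a b) (s1 a' b'))
  | SR_4b a b a' b' :
      star_rel (LBr (s1 a b) (s1 a' b')) (s2 (abB a b) (abA a' b'))
  | SR_5a a b a' b' :
      star_rel (s1 (baA b a) (baB b' a')) (LBr (s2 b a) (s2 b' a'))
  | SR_5b a b a' b' :
      star_rel (LBr (s2 b a) (s2 b' a')) (s2 (baB b a) (baA b' a'))
  | SR_6a a b a' b' :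
      star_rel (s1 (abA a b) (baB b' a')) (LBr (s1 a b) (s2 b' a'))
  | SR_6b a b a' b' :
      star_rel (LBr (s1 a b) (s2 b' a')) (s2 (abB a b) (baA b' a'))
  | SR_7a a b a' b' :
      star_rel (s1 (baA b a) (abB a' b')) (LBr (s2 b a) (s1 a' b'))
  | SR_7b a b a' b' :
      star_rel (LBr (s2 b a) (s1 a' b')) (s2 (baB b a) (abA a' b')).

Definition star := leib_pres star_rel.
HB.instance Definition _ := Leibniz.on star.

Definition star1 (a : IA) (b : IB) : star := leib_gen star_rel (inl (a, b)).
Definition star2 (b : IB) (a : IA) : star := leib_gen star_rel (inr (b, a)).

(* The elements c *_1 c' - c *_2 c', for c and c' in both ideals. They are central
   in [star], so the ideal they generate is their linear span. *)
Inductive diag_star : star -> Prop :=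
  DiagStar c (cA : c \in ideal_pred A) (cB : c \in ideal_pred B)
      c' (c'A : c' \in ideal_pred A) (c'B : c' \in ideal_pred B) :
    diag_star (star1 (IdealAlg cA) (IdealAlg c'B) -
               star2 (IdealAlg cB) (IdealAlg c'A)).

Definition ext := quotI (genI diag_star).
HB.instance Definition _ := Leibniz.on ext.

Definition ext1 (a : IA) (b : IB) : ext := quotI_pi (genI diag_star) (star1 a b).
Definition ext2 (b : IB) (a : IA) : ext := quotI_pi (genI diag_star) (star2 b a).

Lemma capI_ab_subproof (a : IA) (b : IB) :
  {[ ideal_val a, ideal_val b ]} \in capI A B.
Proof.
by apply/andP; split; [apply: ideal_lbrr | apply: ideal_lbrl]; apply: ideal_valP.
Qed.
Lemma capI_ba_subproof (b : IB) (a : IA) :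
  {[ ideal_val b, ideal_val a ]} \in capI A B.
Proof.
by apply/andP; split; [apply: ideal_lbrl | apply: ideal_lbrr]; apply: ideal_valP.
Qed.

Definition theta_symb (x : star_symb) : ideal_alg (capI A B) :=
  match x with
  | inl (a, b) => IdealAlg (capI_ab_subproof a b)
  | inr (b, a) => IdealAlg (capI_ba_subproof b a)
  end.

Let theta_symb1 a b : ideal_val (theta_symb (inl (a, b))) = {[ ideal_val a, ideal_val b ]}.
Proof. by []. Qed.
Let theta_symb2 a b : ideal_val (theta_symb (inr (b, a))) = {[ ideal_val b, ideal_val a ]}.
Proof. by []. Qed.

Lemma theta_symb_rel s t : star_rel s t ->
  leib_eval theta_symb s = leib_eval theta_symb t.
Proof.
case=> *; apply: ideal_val_inj; cbn [leib_eval s1 s2 LSub LOpp].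
all: rewrite ?(ideal_valD, ideal_valZ, ideal_val_br, theta_symb1, theta_symb2).
all: rewrite ?(ideal_valD, ideal_valZ, ideal_val_br) ?(lbr_linearl, lbr_linearr) //.
all: rewrite ?scaleN1r //= lbr_leibniz ?opprB ?addrA ?subrK ?addrK //.
all: by [rewrite addrAC subrr add0r | rewrite lbr_leibniz opprB].
Qed.

Definition theta_star : star -> ideal_alg (capI A B) :=
  leib_pres_lift (R := star_rel) theta_symb.

Lemma theta_star_linear : linear theta_star.
Proof. exact: (leib_pres_lift_linear theta_symb_rel). Qed.
Lemma theta_star_br x y :
  theta_star {[ x, y ]} = {[ theta_star x, theta_star y ]}.
Proof. exact: (leib_pres_lift_br theta_symb_rel). Qed.

Lemma theta_star_diag x : x \in genI diag_star -> theta_star x = 0.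
Proof.
move=> xI; apply/eqP; move: x xI.
apply: (genI_min (I := kerI theta_star_linear theta_star_br)).
move=> _ [c cA cB c' c'A c'B]; rewrite inE -scaleN1r addrC theta_star_linear.
rewrite /theta_star !(leib_pres_liftE theta_symb_rel) scaleN1r addrC subr_eq0.
by apply/eqP/ideal_val_inj.
Qed.

Definition theta : ext -> ideal_alg (capI A B) :=
  quotI_lift (I := genI diag_star) theta_star.

Lemma thetaE1 a b : ideal_val (theta (ext1 a b)) = {[ ideal_val a, ideal_val b ]}.
Proof.
rewrite /theta /ext1 (quotI_liftE theta_star_linear theta_star_diag).
by rewrite /theta_star (leib_pres_liftE theta_symb_rel).
Qed.
Lemma thetaE2 b a : ideal_val (theta (ext2 b a)) = {[ ideal_val b, ideal_val a ]}.
Proof.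
rewrite /theta /ext2 (quotI_liftE theta_star_linear theta_star_diag).
by rewrite /theta_star (leib_pres_liftE theta_symb_rel).
Qed.

Lemma theta_linear : linear theta.
Proof. exact: (quotI_lift_linear theta_star_linear theta_star_diag). Qed.
Lemma theta_br x y : theta {[ x, y ]} = {[ theta x, theta y ]}.
Proof.
exact: (quotI_lift_br theta_star_linear theta_star_br theta_star_diag).
Qed.
HB.instance Definition _ :=
  GRing.isLinear.Build K ext (ideal_alg (capI A B)) *:%R theta theta_linear.
HB.instance Definition _ :=
  isBracketMorphism.Build K ext (ideal_alg (capI A B)) theta theta_br.

End ExteriorProduct.
Arguments theta {K L} A B _.

Definition free_leibniz (K : fieldType) (F : leibnizType K) (X : Type)
    (i : X -> F) : Prop :=
  forall (H : leibnizType K) (j : X -> H),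
  exists phi : {leibniz F -> H}, (forall x, phi (i x) = j x) /\
    (forall psi : {leibniz F -> H}, (forall x, psi (i x) = j x) -> psi =1 phi).

Section ShortExact.
Variables (K : fieldType) (r f g : leibnizType K).

Definition short_exact (iota : {leibniz r -> f}) (pi : {leibniz f -> g}) : Prop :=
  [/\ injective iota,
      (forall x, pi x = 0 <-> exists y, iota y = x)
    & (forall z, exists x, pi x = z)].

Variables (iota : {leibniz r -> f}) (pi : {leibniz f -> g}).
Hypothesis ses : short_exact iota pi.

Definition imI_pred : {pred f} := [pred x | `[< exists y, iota y = x >]].

Lemma imI_predE x : (x \in imI_pred) = (pi x == 0).
Proof. by have [_ ex _] := ses; apply/asboolP/eqP => /ex. Qed.
Lemma imI_submod : submod_closed imI_pred.
Proof.
split=> [|a x y]; rewrite !imI_predE ?linear0 // => /eqP px /eqP py.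
by rewrite linearP /= px py scaler0 addr0.
Qed.
Lemma imI_lbrl x a : a \in imI_pred -> {[ x, a ]} \in imI_pred.
Proof. by rewrite !imI_predE lbr_morph => /eqP ->; rewrite lbr0r. Qed.
Lemma imI_lbrr a x : a \in imI_pred -> {[ a, x ]} \in imI_pred.
Proof. by rewrite !imI_predE lbr_morph => /eqP ->; rewrite lbr0l. Qed.

(* [r], viewed as an ideal of [f]. *)
Definition imI : ideal f := Ideal imI_submod imI_lbrl imI_lbrr.

End ShortExact.

(* Main.v *)
(** Let [K_n] be the kernel of the map from [f^(n)] to [g^(n)] on n-th tensor
    powers; it is spanned by the tensors with an entry in [r]. The defining
    relations of the exterior product of [r] and [f] say exactly that it is
    [K_2 / d K_3], the bracket of [u] and [v] being [d u (x) d v], and theta is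
    then induced by [d]. So the kernel of theta is [H_2(K)], which the long exact
    sequence of [K -> CL f -> CL g] identifies with [HL_3 g], because
    [HL_2 f = HL_3 f = 0].

    The vanishing comes from an explicit contracting homotopy. A free Leibniz
    algebra [f] is a free right module over its enveloping algebra: a linear map
    out of [f] may be defined by its values on the generators [x] and by its
    behaviour under the operators [[-, x]]. This makes sense of the recursion
    [h (m (x) x) = 0],
    [h (m (x) [y, x]) = (-1)^n m (x) y (x) x - h (m . x (x) y)]. *)
Require Import Defs.
From HB Require Import structures.
From mathcomp Require Import all_boot all_order all_algebra.
From mathcomp.classical Require Import boolp classical_sets functions.

Set Implicit Arguments.
Unset Strict Implicit.
Unset Printing Implicit Defensive.

Import GRing.Theory.
Local Open Scope ring_scope.

(** * Linear maps given as bare functions, and maps out of presented modules *)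

Section Linearity.
Variables (K : fieldType) (U V : lmodType K).

Lemma linear_on_add (f : U -> V) : linear f -> {morph f : x y / x + y}.
Proof. by move=> fP x y; have := fP 1 x y; rewrite !scale1r. Qed.
Lemma linear_on0 (f : U -> V) : linear f -> f 0 = 0.
Proof. by move=> /linear_on_add fD; apply: (addIr (f 0)); rewrite -fD !add0r. Qed.
Lemma linear_on_scale (f : U -> V) : linear f -> forall a, {morph f : x / a *: x}.
Proof. by move=> fP a x; have := fP a x 0; rewrite linear_on0 // !addr0. Qed.

(** Bundling makes the generic lemmas on linear maps available for functions obtained by a lift or a
    choice. *)
Definition lin_of (f : U -> V) (fP : linear f) : {linear U -> V} :=
  HB.pack f (GRing.isLinear.Build K U V *:%R f fP).

Lemma lin_ofE f fP x : @lin_of f fP x = f x. Proof. by []. Qed.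

End Linearity.

Section Presented.
Variables (K : fieldType) (G : Type) (R : lmod_term K G -> lmod_term K G -> Prop).

Lemma lmod_pres_ind (V : lmodType K) (f g : lmod_pres R -> V) :
  linear f -> linear g -> (forall x, f (lmod_gen R x) = g (lmod_gen R x)) ->
  f =1 g.
Proof.
move=> fP gP fg u; rewrite -[u]lmod_reprK; elim: (lmod_repr u).
- exact: fg.
- by rewrite [lmod_pi _](lmod_pi0 (lmod_pres_pre R)) !linear_on0.
- move=> s Hs t Ht.
  by rewrite [lmod_pi _](lmod_piD (P := lmod_pres_pre R)) !linear_on_add // Hs Ht.
- move=> a s Hs.
  by rewrite [lmod_pi _](lmod_piZ (P := lmod_pres_pre R)) !linear_on_scale // Hs.
Qed.

End Presented.

(** * Tensor powers, one last factor at a time *)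

Section TensorPowers.
Variables (K : fieldType) (L : leibnizType K).
Implicit Types (a : K) (u v : L).

Lemma CL_ext n (V : lmodType K) (f g : CL L n -> V) : linear f -> linear g ->
  (forall x, f (tens x) = g (tens x)) -> f =1 g.
Proof. exact: lmod_pres_ind. Qed.

Definition rconsf n (x : {ffun 'I_n -> L}) u : {ffun 'I_n.+1 -> L} :=
  [ffun k => if unlift ord_max k is Some j then x j else u].
Definition initf n (x : {ffun 'I_n.+1 -> L}) : {ffun 'I_n -> L} :=
  [ffun k => x (lift ord_max k)].

Lemma rconsf_initf n (x : {ffun 'I_n.+1 -> L}) :
  rconsf (initf x) (x ord_max) = x.
Proof.
by apply/ffunP => k; rewrite !ffunE; case: unliftP => [j|] ->; rewrite ?ffunE.
Qed.

Lemma initf_rconsf n (x : {ffun 'I_n -> L}) u : initf (rconsf x u) = x.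
Proof. by apply/ffunP => k; rewrite !ffunE liftK. Qed.

Lemma rconsf_max n (x : {ffun 'I_n -> L}) u : rconsf x u ord_max = u.
Proof. by rewrite !ffunE unlift_none. Qed.

Lemma rconsf_lift n (x : {ffun 'I_n -> L}) u k : rconsf x u (lift ord_max k) = x k.
Proof. by rewrite !ffunE liftK. Qed.

Lemma rconsf_upd n (x : {ffun 'I_n -> L}) p v u :
  rconsf (upd x p v) u = upd (rconsf x u) (lift ord_max p) v.
Proof.
apply/ffunP => k; rewrite !ffunE; case: unliftP => [j|] ->.
  by rewrite (inj_eq lift_inj) ffunE.
by rewrite (negbTE (neq_lift _ _)).
Qed.

Lemma tens_upd n (x : {ffun 'I_n -> L}) p a u v :
  tens (upd x p (a *: u + v)) = a *: tens (upd x p u) + tens (upd x p v).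
Proof. exact: lmod_pres_rel (TensorRel x p a u v). Qed.

Section Snoc.
Variable n : nat.

Lemma snoc_rel u s t : @tensor_rel K L n s t ->
  lmod_eval (fun x => tens (rconsf x u)) s =
  lmod_eval (fun x => tens (rconsf x u)) t.
Proof. by case=> x p a y z /=; rewrite !rconsf_upd tens_upd. Qed.

(** The tensor m (x) u. With [CL_lift] it presents CL_(n+1) as CL_n (x) L, so that chains can be
    treated by recursion on the last factor, as the contracting homotopy requires. *)
Definition snoc (m : CL L n) u : CL L n.+1 :=
  lmod_pres_lift (fun x => tens (rconsf x u)) m.

Lemma snoc_tens x u : snoc (tens x) u = tens (rconsf x u).
Proof. exact: (lmod_pres_liftE (@snoc_rel u)). Qed.
Lemma snoc_linearl u : linear (snoc^~ u).
Proof. exact: (lmod_pres_lift_linear (@snoc_rel u)). Qed.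
Lemma snoc_linearr m : linear (snoc m).
Proof.
move=> a u v; move: m; apply: CL_ext.
- exact: snoc_linearl.
- move=> b m m'; rewrite !snoc_linearl scalerDr !scalerDr !scalerA addrACA.
  by rewrite mulrC.
move=> x; rewrite !snoc_tens; apply: (@tens_linear _ _ _ _ _ _ ord_max).
- by rewrite !rconsf_max.
- by move=> k; rewrite !ffunE; case: unliftP => [j|] ->; rewrite ?eqxx.
- by move=> k; rewrite !ffunE; case: unliftP => [j|] ->; rewrite ?eqxx.
Qed.

Lemma snocDl u m m' : snoc (m + m') u = snoc m u + snoc m' u.
Proof. exact: (linear_on_add (@snoc_linearl u)). Qed.
Lemma snocZl u a m : snoc (a *: m) u = a *: snoc m u.
Proof. exact: (linear_on_scale (@snoc_linearl u)). Qed.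
Lemma snoc0l u : snoc 0 u = 0.
Proof. exact: (linear_on0 (@snoc_linearl u)). Qed.
Lemma snocBl u m m' : snoc (m - m') u = snoc m u - snoc m' u.
Proof. by rewrite -scaleN1r snocDl snocZl scaleN1r. Qed.
Lemma snocDr m u u' : snoc m (u + u') = snoc m u + snoc m u'.
Proof. exact: (linear_on_add (@snoc_linearr m)). Qed.
Lemma snocZr m a u : snoc m (a *: u) = a *: snoc m u.
Proof. exact: (linear_on_scale (@snoc_linearr m)). Qed.
Lemma snoc0r m : snoc m 0 = 0.
Proof. exact: (linear_on0 (@snoc_linearr m)). Qed.
Lemma snocBr m u u' : snoc m (u - u') = snoc m u - snoc m u'.
Proof. by rewrite -scaleN1r snocDr snocZr scaleN1r. Qed.

Lemma CL_extS (V : lmodType K) (f g : CL L n.+1 -> V) : linear f -> linear g ->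
  (forall m u, f (snoc m u) = g (snoc m u)) -> f =1 g.
Proof.
move=> fP gP fg; apply: CL_ext => // x.
by rewrite -[x]rconsf_initf -snoc_tens fg.
Qed.

Section Lift.
Variables (V : lmodType K) (B : CL L n -> L -> V).
Hypotheses (Bl : forall u, linear (B^~ u)) (Br : forall m, linear (B m)).

Let B0 (x : {ffun 'I_n.+1 -> L}) := B (tens (initf x)) (x ord_max).

(** The factor in which a tensor relation expands is either the last one, where [Br] applies, or an
    earlier one, where [Bl] does. *)
Lemma CL_lift_rel s t : @tensor_rel K L n.+1 s t ->
  lmod_eval B0 s = lmod_eval B0 t.
Proof.
case=> x p a u v /=; rewrite /B0; have [j ->|->] := unliftP ord_max p.
  have E w : initf (upd x (lift ord_max j) w) = upd (initf x) j w.
    by apply/ffunP => k; rewrite !ffunE (inj_eq lift_inj).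
  have Ex w : upd x (lift ord_max j) w ord_max = x ord_max.
    by rewrite ffunE (negbTE (neq_lift _ _)).
  by rewrite !E tens_upd !Ex Bl.
have E w : initf (upd x ord_max w) = initf x.
  by apply/ffunP => k; rewrite !ffunE eq_sym (negbTE (neq_lift _ _)).
have Ex w : upd x ord_max w ord_max = w by rewrite ffunE eqxx.
by rewrite !E !Ex Br.
Qed.

Definition CL_lift : CL L n.+1 -> V := lmod_pres_lift B0.

Lemma CL_lift_linear : linear CL_lift.
Proof. exact: (lmod_pres_lift_linear CL_lift_rel). Qed.

Lemma CL_liftE m u : CL_lift (snoc m u) = B m u.
Proof.
move: m; apply: CL_ext => [a m m'||x]; first by rewrite snoc_linearl CL_lift_linear.
  exact: Bl.
rewrite snoc_tens [LHS](lmod_pres_liftE CL_lift_rel) /B0.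
by rewrite initf_rconsf rconsf_max.
Qed.

End Lift.
End Snoc.

End TensorPowers.

(** * The differential and the diagonal action *)

Section Boundary.
Variables (K : fieldType) (L : leibnizType K).
Implicit Types (u v w : L).

Lemma big_ord_recr_lift n (V : nmodType) (F : 'I_n.+1 -> V) :
  \sum_i F i = \sum_(i < n) F (lift ord_max i) + F ord_max.
Proof.
rewrite big_ord_recr /=; congr (_ + _); apply: eq_bigr => i _; congr F.
by apply/val_inj; rewrite /= /bump leqNgt ltn_ord.
Qed.

(* The diagonal right action [m . u] of [L] on its tensor powers. *)
Fixpoint act n : CL L n -> L -> CL L n :=
  match n with
  | 0 => fun _ _ => 0
  | n.+1 => fun m u =>
      CL_lift (fun m' v => snoc (act m' u) v + snoc m' {[ v, u ]}) m
  end.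

Lemma act_step_linearr n u (m : CL L n) :
  linear (fun v => snoc (act m u) v + snoc m {[ v, u ]}).
Proof.
by move=> a v w; rewrite lbr_linearl !snoc_linearr scalerDr addrACA.
Qed.

Lemma act_step_linearl n u v : linear (@act n ^~ u) ->
  linear (fun m : CL L n => snoc (act m u) v + snoc m {[ v, u ]}).
Proof. by move=> actP a m m'; rewrite actP !snoc_linearl scalerDr addrACA. Qed.

Lemma act_linearl n u : linear (@act n ^~ u).
Proof.
elim: n => [|n IH]; first by move=> a m m'; rewrite /= scaler0 add0r.
apply: CL_lift_linear => *; first exact: act_step_linearl.
exact: act_step_linearr.
Qed.

Lemma act_snoc n (m : CL L n) u v :
  act (snoc m v) u = snoc (act m u) v + snoc m {[ v, u ]}.
Proof.
apply: CL_liftE => *; last exact: act_step_linearr.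
by apply: act_step_linearl; apply: act_linearl.
Qed.

Lemma actD n u (m m' : CL L n) : act (m + m') u = act m u + act m' u.
Proof. exact: (linear_on_add (@act_linearl n u)). Qed.
Lemma actZ n u a (m : CL L n) : act (a *: m) u = a *: act m u.
Proof. exact: (linear_on_scale (@act_linearl n u)). Qed.

(** In this form the action occurs in the differential: it collects the terms that delete the last
    factor. *)
Lemma act_tens n (x : {ffun 'I_n -> L}) u :
  act (tens x) u = \sum_i tens (upd x i {[ x i, u ]}).
Proof.
elim: n x => [|n IH] x; first by rewrite big_ord0.
rewrite -[x in LHS]rconsf_initf -snoc_tens act_snoc IH big_ord_recr_lift.
congr (_ + _).
  rewrite (big_morph (@snoc K L n ^~ _) (id1 := 0) (op1 := +%R)); first last.
  - exact: snoc0l.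
  - by move=> m m'; apply: snocDl.
  apply: eq_bigr => i _; rewrite snoc_tens rconsf_upd rconsf_initf.
  by rewrite ffunE.
rewrite snoc_tens; congr tens; apply/ffunP => k; rewrite !ffunE.
by case: unliftP => [j|] ->; rewrite ?eqxx // eq_sym (negbTE (neq_lift _ _)) ffunE.
Qed.

Arguments act : simpl never.

Lemma contract_rconsf n (x : {ffun 'I_n.+1 -> L}) u i j :
  contract (rconsf x u) (lift ord_max i) (lift ord_max j) =
  rconsf (contract x i j) u.
Proof.
have E (k : 'I_n) :
    lift (lift ord_max j) (lift ord_max k) = lift ord_max (lift j k).
  apply/val_inj; rewrite /= /bump !(leqNgt n) !(leqNgt n.+1) !ltn_ord /= !add0n.
  have : (lift j k < n.+1)%N by apply: ltn_ord.
  by rewrite /= /bump => ->.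
have Em : lift (lift ord_max j) (ord_max : 'I_n.+1) = ord_max.
  apply/val_inj; rewrite /= /bump !(leqNgt n.+1) !ltn_ord /= !add0n.
  by rewrite -ltnS ltn_ord.
apply/ffunP => k; rewrite [LHS]ffunE !rconsf_lift.
have [k' ->|->] := unliftP ord_max k.
  by rewrite E (inj_eq lift_inj) !rconsf_lift ffunE.
by rewrite Em (negbTE (neq_lift _ _)) !rconsf_max.
Qed.

Lemma contract_rconsf_max n (x : {ffun 'I_n.+1 -> L}) u i :
  contract (rconsf x u) (lift ord_max i) ord_max = upd x i {[ x i, u ]}.
Proof.
by apply/ffunP => k; rewrite !ffunE (inj_eq lift_inj) !liftK unlift_none.
Qed.

(** The pairs i < j with j not last give the boundary of m; those with j last give the action of u.
    Counted from 0, the last index is n + 1, whence the sign (-1)^(n+2) = (-1)^n. *)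
Lemma bnd_snoc n (m : CL L n.+1) u :
  bnd (snoc m u) = snoc (bnd m) u + (-1) ^+ n *: act m u.
Proof.
move: m; apply: CL_ext => [a m m'|a m m'|x].
- by rewrite snoc_linearl !linearP.
- rewrite act_linearl linearP snoc_linearl !scalerDr !scalerA mulrC.
  by rewrite addrACA.
rewrite snoc_tens !bndE /bnd_gen big_ord_recr_lift /=.
rewrite [X in _ + X]big1 ?addr0 => [|j]; last first.
  by rewrite ltnNge -ltnS ltn_ord.
under eq_bigr => i _ do rewrite big_mkcond big_ord_recr_lift /=.
have E (k : 'I_n.+1) : bump n.+1 k = k by rewrite /bump leqNgt ltn_ord.
rewrite big_split /=; congr (_ + _); last first.
  rewrite act_tens scaler_sumr; apply: eq_bigr => i _.
  rewrite contract_rconsf_max E ltn_ord.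
  by rewrite !exprS mulrA mulrNN mulr1 mul1r.
rewrite (big_morph (@snoc K L n ^~ u) (id1 := 0) (op1 := +%R)); first last.
- exact: snoc0l.
- by move=> m m'; apply: snocDl.
apply: eq_bigr => i _; rewrite -big_mkcond.
rewrite (big_morph (@snoc K L n ^~ u) (id1 := 0) (op1 := +%R)); first last.
- exact: snoc0l.
- by move=> m m'; apply: snocDl.
rewrite /= !E.
apply: eq_big => [j|j ij]; first by rewrite !E.
by rewrite contract_rconsf snocZl snoc_tens E.
Qed.

Lemma bnd1 (m : CL L 1) : bnd m = 0.
Proof.
move: m; apply: CL_ext => [a m m'|a m m'|x]; first by rewrite linearP.
  by rewrite scaler0 addr0.
by rewrite bndE /bnd_gen big_ord1 big_mkcond big_ord1.
Qed.

(** In each factor this is the Leibniz identity; the terms in which u and v act on different factors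
    cancel. *)
Lemma act_br n (m : CL L n) u v :
  act m {[ u, v ]} = act (act m u) v - act (act m v) u.
Proof.
elim: n m => [|n IH]; first by move=> m; rewrite subr0.
apply: CL_extS => [||m w]; first exact: act_linearl.
  by move=> a m m'; rewrite !act_linearl scalerBr opprD addrACA.
rewrite !act_snoc !actD !act_snoc IH lbr_leibniz snocBl snocBr.
move: (snoc (act (act m u) v) w) (snoc (act (act m v) u) w) => A B.
move: (snoc m {[ {[ w, u ]}, v ]}) (snoc m {[ {[ w, v ]}, u ]}) => C D.
move: (snoc (act m u) {[ w, v ]}) (snoc (act m v) {[ w, u ]}) => E F.
rewrite [A + E + _](AC (2*2) ((1*4)*(2*3))) [B + F + _](AC (2*2) ((1*4)*(3*2))).
by rewrite [in RHS]opprD [RHS]addrACA subrr addr0 opprD addrACA.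
Qed.

(** Induction on the last factor v: the action of [v, u] on m, produced by [bnd_snoc], exchanges the
    order of the actions of u and v by [act_br]. *)
Lemma bnd_act n (m : CL L n.+1) u : bnd (act m u) = act (bnd m) u.
Proof.
elim: n m => [|n IH] m; first by rewrite !bnd1.
move: m; apply: CL_extS => [a m m'|a m m'|m v];
  rewrite ?act_linearl ?linearP ?act_linearl //.
rewrite act_snoc linearD /= !bnd_snoc actD act_snoc actZ IH.
by rewrite addrACA -scalerDr act_br [act _ v + _]addrC subrK.
Qed.

(** For m (x) u, the action of u on the boundary of m occurs twice, the second time through
    [bnd_act]; the signs are opposite because the lengths differ by one. *)
Lemma bnd_bnd n (m : CL L n) : bnd (bnd m) = 0.
Proof.
case: n m => [|[|n]] m.
- move: m; apply: CL_ext => [a m m'|a m m'|x]; rewrite ?linearP //=.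
    by rewrite scaler0 addr0.
  by rewrite bndE /bnd_gen big_ord0 linear0.
- by rewrite bnd1 linear0.
elim: n m => [|n IH]; first by move=> m; rewrite bnd1.
apply: CL_extS => [a m m'|a m m'|m u]; rewrite ?linearP // ?scaler0 ?addr0 //.
rewrite bnd_snoc linearD /= bnd_snoc IH snoc0l add0r linearZ /= bnd_act exprS mulN1r.
by rewrite scaleNr addrN.
Qed.

End Boundary.

Arguments act : simpl never.

(** * Maps induced on chains *)

Section Functoriality.
Variables (K : fieldType) (L M : leibnizType K).

Fixpoint CL_map (phi : L -> M) n : CL L n -> CL M n :=
  match n with
  | 0 => fun m => lmod_pres_lift (fun _ => tens [ffun=> 0]) m
  | n.+1 => CL_lift (fun m u => snoc (CL_map phi m) (phi u))
  end.

Section Linear.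
Variable phi : {linear L -> M}.

Lemma CL_map_linear n : linear (@CL_map phi n).
Proof.
elim: n => [|n IH].
  by apply: lmod_pres_lift_linear => s t [x []].
rewrite -[CL_map _ (n := _)]/(CL_lift (fun m u => snoc (@CL_map phi n m) (phi u))).
apply: CL_lift_linear => [u a m m'|m a u v].
  by rewrite IH snoc_linearl.
by rewrite linearP snoc_linearr.
Qed.
HB.instance Definition _ n := GRing.isLinear.Build K (CL L n) (CL M n) *:%R
  (@CL_map phi n) (@CL_map_linear n).

Lemma CL_map_snoc n (m : CL L n) u :
  CL_map phi (snoc m u) = snoc (CL_map phi m) (phi u).
Proof.
apply: (@CL_liftE _ _ _ _ (fun m u => snoc (CL_map phi m) (phi u)))
  => [{}u a {}m m'|{}m a {}u v].
  by rewrite linearP snoc_linearl.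
by rewrite linearP snoc_linearr.
Qed.
End Linear.
Arguments CL_map : simpl never.

Section Morphism.
Variable phi : {leibniz L -> M}.

Lemma CL_map_act n (m : CL L n) u :
  CL_map phi (act m u) = act (CL_map phi m) (phi u).
Proof.
elim: n m => [|n IH]; first by move=> m; exact: linear0.
apply: CL_extS => [a m m'|a m m'|m v];
  rewrite ?act_linearl ?linearP ?act_linearl //.
by rewrite act_snoc linearD /= !CL_map_snoc act_snoc IH /= lbr_morph.
Qed.

Lemma CL_map_bnd n (m : CL L n) : CL_map phi (bnd m) = bnd (CL_map phi m).
Proof.
case: n m => [|[|n]] m.
- move: m; apply: CL_ext => [a m m'|a m m'|x]; rewrite ?linearP //=.
  rewrite bndE /bnd_gen big_ord0 linear0.
  rewrite [CL_map _ _](lmod_pres_liftE (j := fun _ => tens [ffun=> 0])) ?bndE.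
    by rewrite /bnd_gen big_ord0.
  by move=> s t [x' []].
- by rewrite !bnd1 linear0.
elim: n m => [|n IH] m.
  move: m; apply: CL_extS => [a m m'|a m m'|m u]; rewrite ?linearP //.
  by rewrite CL_map_snoc !bnd_snoc !bnd1 !snoc0l !add0r linearZ /= CL_map_act.
move: m; apply: CL_extS => [a m m'|a m m'|m u]; rewrite ?linearP //.
by rewrite CL_map_snoc !bnd_snoc linearD linearZ /= CL_map_act CL_map_snoc IH.
Qed.
End Morphism.
End Functoriality.
Arguments CL_map : simpl never.

(** * Subalgebras and hemisemidirect products, two targets for the universal property *)

Section Subalgebra.
Variables (K : fieldType) (L : leibnizType K).

Record subalg := Subalg {
  subalg_pred :> {pred L};
  subalg_submod : submod_closed subalg_pred;
  subalg_lbr : forall x y, x \in subalg_pred -> y \in subalg_pred ->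
    {[ x, y ]} \in subalg_pred
}.

HB.instance Definition _ (S : subalg) :=
  GRing.isSubmodClosed.Build K L (subalg_pred S) (subalg_submod S).

Variable S : subalg.

Record subalg_alg := SubalgAlg { subalg_val :> L; _ : subalg_val \in subalg_pred S }.
HB.instance Definition _ := [isSub for subalg_val].
HB.instance Definition _ := [Choice of subalg_alg by <:].
HB.instance Definition _ := [SubChoice_isSubLmodule of subalg_alg by <:].

Definition subalg_br (a b : subalg_alg) : subalg_alg :=
  SubalgAlg (subalg_lbr (valP a) (valP b)).

Lemma subalg_val_inj : injective subalg_val.
Proof. exact: val_inj. Qed.
Lemma subalg_val_linear : linear subalg_val.
Proof. by move=> a x y; exact: (linearP \val). Qed.
Lemma subalg_valB x y : subalg_val (x - y) = subalg_val x - subalg_val y.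
Proof. exact: (raddfB \val). Qed.
Let brE x y : subalg_val (subalg_br x y) = {[ subalg_val x, subalg_val y ]}.
Proof. by []. Qed.

Lemma subalg_br_linearl z (c : K) a b :
  subalg_br (c *: a + b) z = c *: subalg_br a z + subalg_br b z.
Proof.
by apply: subalg_val_inj; rewrite !(brE, subalg_val_linear) lbr_linearl.
Qed.
Lemma subalg_br_linearr z (c : K) a b :
  subalg_br z (c *: a + b) = c *: subalg_br z a + subalg_br z b.
Proof.
by apply: subalg_val_inj; rewrite !(brE, subalg_val_linear) lbr_linearr.
Qed.
Lemma subalg_br_leibniz a b c :
  subalg_br a (subalg_br b c) =
    subalg_br (subalg_br a b) c - subalg_br (subalg_br a c) b.
Proof. by apply: subalg_val_inj; rewrite subalg_valB !brE lbr_leibniz. Qed.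
HB.instance Definition _ := Lmodule_isLeibniz.Build K subalg_alg
  subalg_br_linearl subalg_br_linearr subalg_br_leibniz.

End Subalgebra.

Section Hemisemidirect.
Variables (K : fieldType) (M : lmodType K).
Local Notation pair := ((M -> M) * M)%type.

Definition hemi_pred : {pred pair} := [pred p | `[< linear p.1 >]].

Lemma hemi_submod : submod_closed hemi_pred.
Proof.
split=> [|a p q].
  by apply/asboolP => b x y; rewrite /= scaler0 addr0.
move=> /asboolP pP /asboolP qP; apply/asboolP => b x y /=.
by rewrite !fctE pP qP !scalerDr !scalerA mulrC addrACA.
Qed.
HB.instance Definition _ :=
  GRing.isSubmodClosed.Build K pair hemi_pred hemi_submod.

(* The hemisemidirect product of the Lie algebra [End(M)^op], which acts on [M]
   on the right, by [M]. *)
Record hemi := Hemi { hemi_val :> pair; _ : hemi_val \in hemi_pred }.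
HB.instance Definition _ := [isSub for hemi_val].
HB.instance Definition _ := [Choice of hemi by <:].
HB.instance Definition _ := [SubChoice_isSubLmodule of hemi by <:].

Lemma hemiP (p : hemi) : linear (hemi_val p).1.
Proof. exact/asboolP/(valP p). Qed.

Lemma hemi_eq (p q : hemi) : (hemi_val p).1 =1 (hemi_val q).1 ->
  (hemi_val p).2 = (hemi_val q).2 -> p = q.
Proof.
move=> eq1 eq2; apply: val_inj; rewrite [val p]surjective_pairing.
by rewrite [val q]surjective_pairing [X in (X, _)](funext eq1) eq2.
Qed.
Lemma hemi_linear1 a p q x :
  (hemi_val (a *: p + q)).1 x = a *: (hemi_val p).1 x + (hemi_val q).1 x.
Proof. by rewrite [hemi_val _](linearP \val). Qed.
Lemma hemi_linear2 a p q :
  (hemi_val (a *: p + q)).2 = a *: (hemi_val p).2 + (hemi_val q).2.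
Proof. by rewrite [hemi_val _](linearP \val). Qed.

(** Operators act on the right, so the first component is the commutator for reversed composition.
    The second is the action of q on the vector of p; p does not act on the vector of q, as usual in
    a hemisemidirect product. *)
Definition hemi_br0 (p q : pair) : pair :=
  (fun x => q.1 (p.1 x) - p.1 (q.1 x), q.1 p.2).

Lemma hemi_br_subproof (p q : hemi) : hemi_br0 p q \in hemi_pred.
Proof.
apply/asboolP => a x y /=; rewrite !(hemiP p, hemiP q) scalerBr.
by rewrite opprD addrACA.
Qed.
Definition hemi_br (p q : hemi) : hemi := Hemi (hemi_br_subproof p q).

Lemma hemi_br1 p q x : (hemi_val (hemi_br p q)).1 x =
  (hemi_val q).1 ((hemi_val p).1 x) - (hemi_val p).1 ((hemi_val q).1 x).
Proof. by []. Qed.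
Lemma hemi_br2 p q : (hemi_val (hemi_br p q)).2 = (hemi_val q).1 (hemi_val p).2.
Proof. by []. Qed.

Lemma hemi_br_linearl r a p q :
  hemi_br (a *: p + q) r = a *: hemi_br p r + hemi_br q r.
Proof.
apply: hemi_eq => [x|]; rewrite !(hemi_linear1, hemi_linear2, hemi_br1, hemi_br2).
  by rewrite (hemiP r) scalerBr opprD addrACA.
by rewrite (hemiP r).
Qed.
Lemma hemi_br_linearr r a p q :
  hemi_br r (a *: p + q) = a *: hemi_br r p + hemi_br r q.
Proof.
apply: hemi_eq => [x|]; rewrite !(hemi_linear1, hemi_linear2, hemi_br1, hemi_br2) //.
by rewrite (hemiP r) scalerBr opprD addrACA.
Qed.
Lemma hemi_br_leibniz p q r :
  hemi_br p (hemi_br q r) = hemi_br (hemi_br p q) r - hemi_br (hemi_br p r) q.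
Proof.
have B (s : hemi) : {morph (hemi_val s).1 : x y / x - y}.
  move=> x y; rewrite -scaleN1r addrC.
  by rewrite (hemiP s) scaleN1r addrC.
rewrite -scaleN1r addrC.
apply: hemi_eq => [x|].
  rewrite !(hemi_linear1, hemi_br1) !B scaleN1r.
  move: (hemi_val p).1 (hemi_val q).1 (hemi_val r).1 => P Q R.
  move: (P (R (Q x))) (P (Q (R x))) (R (Q (P x))) (Q (R (P x))) => a b c d.
  move: (R (P (Q x))) (Q (P (R x))) => e f.
  rewrite !opprB.
  rewrite [RHS](AC ((2*2)*(2*2)) (((5*4)*(7*2))*((1*6)*(3*8)))) /=.
  by rewrite !subrr !addr0.
by rewrite !(hemi_linear2, hemi_br2, hemi_br1) scaleN1r addrC.
Qed.
HB.instance Definition _ := Lmodule_isLeibniz.Build K hemi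
  hemi_br_linearl hemi_br_linearr hemi_br_leibniz.
End Hemisemidirect.

Section LeibnizHomOf.
Variables (K : fieldType) (L M : leibnizType K) (h : L -> M).
Hypotheses (hP : linear h) (hB : forall x y, h {[ x, y ]} = {[ h x, h y ]}).

Definition leib_of : {leibniz L -> M} :=
  HB.pack h (GRing.isLinear.Build K L M *:%R h hP)
    (isBracketMorphism.Build K L M h hB).

Lemma leib_ofE x : leib_of x = h x. Proof. by []. Qed.
End LeibnizHomOf.

(** * Induction and recursion in a free Leibniz algebra *)

Section FreeLeibniz.
Variables (K : fieldType) (f : leibnizType K) (X : Type) (i : X -> f).
Hypothesis f_free : free_leibniz i.

Lemma free_leibniz_ext (H : leibnizType K) (phi psi : {leibniz f -> H}) :
  (forall x, phi (i x) = psi (i x)) -> phi =1 psi.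
Proof.
move=> eq_i; have [chi [_ chiU]] := f_free (phi \o i).
by move=> y; rewrite (chiU phi) // (chiU psi) // => x; rewrite -eq_i.
Qed.

(** The homomorphism to S that fixes the generators, followed by the inclusion, is the identity by
    uniqueness. *)
Lemma free_leibniz_subalg (S : subalg f) :
  (forall x, i x \in subalg_pred S) -> forall y, y \in subalg_pred S.
Proof.
move=> SX; have [phi [phiX _]] := f_free (fun x => SubalgAlg (SX x)).
have jP : linear (fun y => subalg_val (phi y)).
  by move=> a y z; rewrite linearP subalg_val_linear.
have jB y z : subalg_val (phi {[ y, z ]}) =
    {[ subalg_val (phi y), subalg_val (phi z) ]} by rewrite lbr_morph.
have idP : linear (@id f) by [].
have idB (y z : f) : id {[ y, z ]} = {[ id y, id z ]} by [].
have jX x : leib_of jP jB (i x) = leib_of idP idB (i x).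
  by rewrite !leib_ofE phiX.
move=> y; have := free_leibniz_ext jX y; rewrite !leib_ofE /= => <-.
exact: valP (phi y).
Qed.

(* As a right module over its universal enveloping algebra, a free Leibniz
   algebra is generated by the generators. *)
Lemma free_leibniz_ind (W : {pred f}) : submod_closed W ->
  (forall x, i x \in W) -> (forall y x, y \in W -> {[ y, i x ]} \in W) ->
  forall y, y \in W.
Proof.
move=> Wlin WX Wbr.
(* [S0] collects the z for which [-, z] preserves W. The Leibniz identity makes it a subalgebra; as
   it contains the generators, it is everything, and then W is a subalgebra too. *)
pose S0 : {pred f} := [pred z | `[< forall y, y \in W -> {[ y, z ]} \in W >]].
have W0 : 0 \in W by case: Wlin.
have WP a x y : x \in W -> y \in W -> a *: x + y \in W by case: Wlin => _; apply.
have WB x y : x \in W -> y \in W -> x - y \in W.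
  by move=> xW yW; rewrite addrC -scaleN1r WP.
have S0P : submod_closed S0.
  split=> [|a x y].
    by apply/asboolP => y yW; rewrite lbr0r.
  move=> /asboolP xS /asboolP yS; apply/asboolP => z zW.
  by rewrite lbr_linearr WP ?xS ?yS.
have S0br x y : x \in S0 -> y \in S0 -> {[ x, y ]} \in S0.
  move=> /asboolP xS /asboolP yS; apply/asboolP => z zW.
  by rewrite lbr_leibniz WB // ?xS ?yS // ?xS ?yS.
have WR y z : y \in W -> {[ y, z ]} \in W.
  have /asboolP : z \in S0; last by apply.
  apply: (@free_leibniz_subalg (Subalg S0P S0br)) => x.
  by apply/asboolP => t; apply: Wbr.
by apply: (@free_leibniz_subalg (Subalg Wlin (fun x y xW _ => WR x y xW))).
Qed.

Lemma free_leibniz_eq (V : lmodType K) (g h : f -> V) : linear g -> linear h ->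
  (forall x, g (i x) = h (i x)) ->
  (forall y x, g y = h y -> g {[ y, i x ]} = h {[ y, i x ]}) -> g =1 h.
Proof.
move=> gP hP eqX eqbr y; apply/eqP; move: y.
apply: (@free_leibniz_ind [pred y | g y == h y]) => [|x|y x]; rewrite ?inE.
- split=> [|a x y]; rewrite !inE ?(linear_on0 gP) ?(linear_on0 hP) //.
  by move=> /eqP ex /eqP ey; rewrite gP hP ex ey.
- exact/eqP.
- by move=> /eqP /eqbr ->.
Qed.

(* Apply the universal property to the hemisemidirect product of [End(M)] and [M]. *)
Lemma free_leibniz_rec (M : lmodType K) (m : X -> M) (rho : X -> M -> M) :
  (forall x, linear (rho x)) ->
  exists phi : f -> M, [/\ linear phi, forall x, phi (i x) = m x
    & forall y x, phi {[ y, i x ]} = rho x (phi y)].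
Proof.
move=> rhoP.
have genP x : (rho x, m x) \in @hemi_pred K M by apply/asboolP/rhoP.
have [phi [phiX _]] := f_free (fun x => Hemi (genP x)).
exists (fun y => (hemi_val (phi y)).2); split=> [a y z|x|y x].
- by rewrite linearP hemi_linear2.
- by rewrite phiX.
by rewrite lbr_morph hemi_br2 phiX.
Qed.

End FreeLeibniz.

(** * The contraction of the complex of a free algebra in degrees at least 2 *)

Section Homotopy.
Variables (K : fieldType) (f : leibnizType K) (X : Type) (i : X -> f).
Hypothesis f_free : free_leibniz i.

Lemma free_homotopy_step n : exists h : CL f n.+1 -> CL f n.+2,
  [/\ linear h, forall m x, h (snoc m (i x)) = 0
    & forall m y x, h (snoc m {[ y, i x ]}) =
        (-1) ^+ n *: snoc (snoc m y) (i x) - h (snoc (act m (i x)) y)].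
Proof.
(* The recursion carries y itself, since its step mentions y and not only the value at y, and a
   function of m, since the step evaluates the previous value at m . x. *)
pose M := (f * (CL f n -> CL f n.+2))%type.
pose rho x (p : M) : M := ({[ p.1, i x ]},
  fun m => (-1) ^+ n *: snoc (snoc m p.1) (i x) - p.2 (act m (i x))).
have rhoP x : linear (rho x).
  move=> a p q; rewrite /rho [RHS]surjective_pairing /=; congr (_, _).
    by rewrite lbr_linearl.
  apply/funext => m; rewrite !fctE /=.
  rewrite snoc_linearr snoc_linearl scalerBr scalerDr opprD addrACA.
  by rewrite !scalerA mulrC.
have [phi [phiP phiX phiB]] := free_leibniz_rec f_free (fun x => (i x, 0) : M) rhoP.
have phi1 y : (phi y).1 = y.
  move: y; apply: (free_leibniz_eq f_free) => [a y z|//|x|y x yE].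
  - by rewrite phiP.
  - by rewrite phiX.
  by rewrite phiB /= yE.
have Hr m : linear (fun y => (phi y).2 m) by move=> a y z; rewrite phiP.
(* [M] holds arbitrary functions of m, so linearity in m needs its own induction on y. *)
have Hl y : linear (phi y).2.
  apply/asboolP; move: y.
  apply: (@free_leibniz_ind _ _ _ _ f_free [pred y | `[< linear (phi y).2 >]]).
  - split=> [|a y z].
      apply/asboolP => a m m'; rewrite (linear_on0 phiP) /=.
      by rewrite -[(0 : _ -> _) _]/(0 : CL f n.+2) scaler0 addr0.
    move=> /asboolP yP /asboolP zP; apply/asboolP => b m m'.
    by rewrite !phiP /= !fctE yP zP !scalerDr !scalerA mulrC addrACA.
  - move=> x; apply/asboolP => a m m'; rewrite phiX /=.
    by rewrite -[(0 : _ -> _) _]/(0 : CL f n.+2) scaler0 addr0.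
  move=> y x /asboolP yP; apply/asboolP => a m m'.
  rewrite phiB /= phi1 act_linearl yP !snoc_linearl scalerBr scalerDr opprD.
  by rewrite !scalerA mulrC addrACA.
exists (CL_lift (fun m y => (phi y).2 m)).
have E m y : CL_lift (fun m y => (phi y).2 m) (snoc m y) = (phi y).2 m.
  exact: CL_liftE.
split=> [|m x|m y x].
- exact: CL_lift_linear.
- by rewrite E phiX.
by rewrite !E phiB /= phi1.
Qed.

(** The map p = d h + h d commutes with d and fixes m (x) x for each generator x; induction on the
    last factor then shows that p is the identity. *)
Theorem free_contraction : exists h : forall n, {linear CL f n.+1 -> CL f n.+2},
  forall n (c : CL f n.+2), bnd (h n.+1 c) + h n (bnd c) = c.
Proof.
pose h n := projT1 (cid (free_homotopy_step n)).
have hP n : linear (h n) by case: (projT2 (cid (free_homotopy_step n))).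
have hX n m x : h n (snoc m (i x)) = 0.
  by case: (projT2 (cid (free_homotopy_step n))) => _ E _; exact: E.
have hB n m y x : h n (snoc m {[ y, i x ]}) =
    (-1) ^+ n *: snoc (snoc m y) (i x) - h n (snoc (act m (i x)) y).
  by case: (projT2 (cid (free_homotopy_step n))) => _ _ E; exact: E.
(* When the action on m (x) y is expanded, the two values of h at (m . x) (x) y cancel. *)
have h_act n m x : h n (act m (i x)) = (-1) ^+ n *: snoc m (i x).
  move: m; apply: CL_extS => [a m m'|a m m'|m y].
  - by rewrite act_linearl hP.
  - by rewrite snoc_linearl scalerDr !scalerA mulrC.
  by rewrite act_snoc (linear_on_add (hP n)) hB addrC subrK.
exists (fun n => lin_of (hP n)) => n c; rewrite !lin_ofE.
pose p n (c : CL f n.+2) := bnd (h n.+1 c) + h n (bnd c).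
have pP n' : linear (p n').
  move=> a m m'; rewrite /p hP !linearP hP.
  by rewrite scalerDr addrACA.
have pX n' m x : p n' (snoc m (i x)) = snoc m (i x).
  rewrite /p hX linear0 add0r bnd_snoc (linear_on_add (hP n')) hX add0r.
  rewrite (linear_on_scale (hP n')) h_act scalerA -exprD addnn -signr_odd.
  by rewrite odd_double scale1r.
have pbnd n' (c' : CL f n'.+3) : p n' (bnd c') = bnd (p n'.+1 c').
  rewrite /p (bnd_bnd c') (linear_on0 (hP n')) addr0 linearD /=.
  by rewrite (bnd_bnd (h n'.+2 c')) add0r.
rewrite -/(p n c); move: n c => n; apply: CL_extS => // m y; move: y m.
suff W y : y \in [pred y | `[< forall m, p n (snoc m y) = snoc m y >]].
  by move=> y; exact/asboolP/W.
move: y; apply: (free_leibniz_ind f_free).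
- split=> [|a y z].
    by apply/asboolP => m; rewrite snoc0r (linear_on0 (pP n)).
  move=> /asboolP yP /asboolP zP; apply/asboolP => m.
  by rewrite snoc_linearr pP yP zP.
- by move=> x; apply/asboolP => m; apply: pX.
move=> y x /asboolP yP; apply/asboolP => m.
(* In the boundary of m (x) y (x) x, all terms but m (x) [y, x] are known to be fixed by p, and p
   fixes the whole boundary because it commutes with d. *)
have := pbnd n (snoc (snoc m y) (i x)).
rewrite pX bnd_snoc act_snoc !(linear_on_add (pP n)) (linear_on_scale (pP n)).
rewrite (linear_on_add (pP n)) pX yP => /addrI /(scalerI _) E.
by apply/addrI/E; rewrite signr_eq0.
Qed.
End Homotopy.

(** * Linear complements of subspaces *)

Section Complements.
Variables (K : fieldType) (V : lmodType K) (W : {pred V}).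
Hypothesis WP : submod_closed W.
Local Open Scope classical_set_scope.

(** By Zorn's lemma there is a maximal subspace A that meets W trivially. It is a complement, and q
    is the projection onto W along A. *)
Lemma linear_retraction : exists q : V -> V,
  [/\ linear q, forall x, q x \in W & forall x, x \in W -> q x = x].
Proof.
have W0 : 0 \in W by case: WP.
have WD a x y : x \in W -> y \in W -> a *: x + y \in W by case: WP => _; apply.
pose P (A : set V) := (forall a x y, A x -> A y -> A (a *: x + y)) /\
  (forall x, A x -> x \in W -> x = 0).
have [|A [[AD AW] Amax]] := @Zorn_bigcup _ P.
  move=> F FP Ftot; split=> [a x y [A FA Ax] [B FB By]|x [A FA Ax]].
    have [AB|BA] := Ftot _ _ FA FB.
      by exists B => //; apply: (FP B FB).1 => //; apply: AB.
    by exists A => //; apply: (FP A FA).1 => //; apply: BA.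
  exact: (FP A FA).2.
(* The empty set also satisfies [P]; comparing A with {0} excludes it. *)
have A0 : A 0.
  apply: contrapT => nA0.
  have nA x : ~ A x.
    by move=> Ax; apply: nA0; have := AD (-1) _ _ Ax Ax; rewrite scaleN1r addNr.
  apply: (Amax [set 0]); first by split=> [x /nA|/(_ 0 erefl)].
  by split=> [a x y -> ->|x ->] //=; rewrite scaler0 addr0.
have AZ a x : A x -> A (a *: x) by move=> Ax; rewrite -[_ *: _]addr0; apply: AD.
have dec v : exists c, A c /\ v - c \in W.
  apply: contrapT => nv.
  (* The span of A and v: if v had no decomposition, it would be strictly larger than A and still
     meet W trivially. *)
  pose B := [set x | exists a c, A c /\ x = a *: v + c].
  apply: (Amax B).
    split=> [c Ac|BA]; first by exists 0, c; rewrite scale0r add0r.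
    apply: nv; exists v; rewrite subrr; split=> //; apply: BA.
    by exists 1, 0; rewrite scale1r addr0.
  split=> [b _ _ [a [c [Ac ->]]] [a' [c' [Ac' ->]]]|_ [a [c [Ac ->]]] xW].
    exists (b * a + a'), (b *: c + c'); split; first exact: AD.
    by rewrite scalerDr scalerA scalerDl addrACA.
  have [a0|a0] := eqVneq a 0.
    by move: xW; rewrite a0 scale0r add0r; apply: AW.
  case: nv; exists (- (a^-1 *: c)); split; first by rewrite -scaleNr; apply: AZ.
  rewrite opprK; have := WD a^-1 _ _ xW W0.
  by rewrite addr0 scalerDr scalerA mulVf // scale1r.
have AU c c' : A c -> A c' -> c - c' \in W -> c = c'.
  move=> Ac Ac' cc'; apply/eqP; rewrite -subr_eq0; apply/eqP/AW => //.
  by rewrite addrC -scaleN1r; apply: AD.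
pose c v := projT1 (cid (dec v)).
have cA v : A (c v) by case: (projT2 (cid (dec v))).
have cW v : v - c v \in W by case: (projT2 (cid (dec v))).
have WB x y : x \in W -> y \in W -> x - y \in W.
  by move=> xW yW; rewrite addrC -scaleN1r WD.
exists (fun v => v - c v); split=> [a x y|//|x xW].
  have -> : c (a *: x + y) = a *: c x + c y.
    apply: AU; [exact: cA|by apply: AD|].
    have := WB _ _ (WD a _ _ (cW x) (cW y)) (cW (a *: x + y)).
    rewrite scalerBr addrACA -opprD opprB.
    by rewrite [X in X \in _ -> _]addrC [X in X \in _ -> _]addrA subrK.
  by rewrite scalerBr opprD addrACA.
have -> : c x = 0; last by rewrite subr0.
by apply: AW => //; rewrite -[c x](subKr x) WB.
Qed.
End Complements.

(** * Central extensions by cocycles *)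

Section CocycleExtension.
Variables (K : fieldType) (C : leibnizType K) (V : lmodType K).

(** A Leibniz 2-cocycle with trivial coefficients: a linear form on 2-chains, with values in V, that
    vanishes on boundaries. *)
Record cocycle := Cocycle {
  cocycle_fun :> C -> C -> V;
  cocycle_linearl : forall y, linear (cocycle_fun^~ y);
  cocycle_linearr : forall x, linear (cocycle_fun x);
  cocycle_leibniz : forall x y z, cocycle_fun x {[ y, z ]} =
    cocycle_fun {[ x, y ]} z - cocycle_fun {[ x, z ]} y
}.

(** The carrier is indexed by the cocycle so that each cocycle determines its own bracket on the
    same product. *)
Definition cocycle_ext of cocycle : Type := (C * V)%type.
HB.instance Definition _ w := GRing.Lmodule.on (cocycle_ext w).

Variable w : cocycle.

Definition cocycle_br (p q : cocycle_ext w) : cocycle_ext w :=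
  ({[ p.1, q.1 ]}, w p.1 q.1).

Lemma cocycle_br_linearl r a p q :
  cocycle_br (a *: p + q) r = a *: cocycle_br p r + cocycle_br q r.
Proof.
rewrite [RHS]surjective_pairing; congr (_, _); first exact: lbr_linearl.
exact: cocycle_linearl.
Qed.
Lemma cocycle_br_linearr r a p q :
  cocycle_br r (a *: p + q) = a *: cocycle_br r p + cocycle_br r q.
Proof.
rewrite [RHS]surjective_pairing; congr (_, _); first exact: lbr_linearr.
exact: cocycle_linearr.
Qed.
Lemma cocycle_br_leibniz p q r : cocycle_br p (cocycle_br q r) =
  cocycle_br (cocycle_br p q) r - cocycle_br (cocycle_br p r) q.
Proof.
rewrite [RHS]surjective_pairing; congr (_, _); first exact: lbr_leibniz.
exact: cocycle_leibniz.
Qed.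
HB.instance Definition _ := Lmodule_isLeibniz.Build K (cocycle_ext w)
  cocycle_br_linearl cocycle_br_linearr cocycle_br_leibniz.

End CocycleExtension.

Lemma leib_eval_morph (K : fieldType) (L M : leibnizType K) (h : L -> M) G
    (j : G -> L) (s : leib_term K G) :
  linear h -> (forall x y, h {[ x, y ]} = {[ h x, h y ]}) ->
  h (leib_eval j s) = leib_eval (h \o j) s.
Proof.
move=> hP hB; elim: s => //= [|s <- t <-|a s <-|s <- t <-] //.
- exact: linear_on0.
- exact: linear_on_add.
- exact: linear_on_scale.
Qed.

(** * Linear maps out of the exterior product *)

Section ExteriorProductTheory.
Variables (K : fieldType) (L : leibnizType K) (A B : ideal L).
Local Notation IA := (ideal_alg A).
Local Notation IB := (ideal_alg B).
Local Notation ext := (ext A B).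
Local Notation star_rel := (@star_rel K L A B).

Let epi := quotI_pi (genI (@diag_star K L A B)).

Let epi_linear : linear epi.
Proof.
move=> a x y; rewrite -[a *: epi x](lmod_piZ (P := quot_premod _)).
by rewrite -[RHS](lmod_piD (P := quot_premod _)).
Qed.
Let epi_br x y : epi {[ x, y ]} = {[ epi x, epi y ]}.
Proof. exact: (leib_piB (P := quotI_pre _)). Qed.

Definition ext_symb (x : star_symb A B) : ext := epi (leib_gen star_rel x).

(** Turns each constructor of [star_rel] into an equation in the exterior product. *)
Lemma ext_rel s t : star_rel s t -> leib_eval ext_symb s = leib_eval ext_symb t.
Proof.
move=> st; rewrite -!(leib_eval_morph _ _ epi_linear epi_br).
by rewrite (leib_pres_rel st).
Qed.

Lemma ext1_linearl b : linear (fun a => ext1 a b : ext).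
Proof. by move=> k a a'; exact: (ext_rel (SR_lin1l k a a' b)). Qed.
Lemma ext1_linearr a : linear (fun b => ext1 a b : ext).
Proof. by move=> k b b'; exact: (ext_rel (SR_lin1r k a b b')). Qed.
Lemma ext2_linearl a : linear (fun b => ext2 b a : ext).
Proof. by move=> k b b'; exact: (ext_rel (SR_lin2l k b b' a)). Qed.
Lemma ext2_linearr b : linear (fun a => ext2 b a : ext).
Proof. by move=> k a a'; exact: (ext_rel (SR_lin2r k b a a')). Qed.

Lemma ext_diag c (cA : c \in ideal_pred A) (cB : c \in ideal_pred B)
    c' (c'A : c' \in ideal_pred A) (c'B : c' \in ideal_pred B) :
  ext1 (IdealAlg cA) (IdealAlg c'B) = ext2 (IdealAlg cB) (IdealAlg c'A) :> ext.
Proof.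
apply/lmod_piP; rewrite /= /eqmodW; apply: genI_sub.
exact: DiagStar.
Qed.

(* The relations 4 to 7 express brackets of generators as generators. *)
Lemma ext_ind (W : {pred ext}) : submod_closed W ->
  (forall a b, ext1 a b \in W) -> (forall b a, ext2 b a \in W) ->
  forall u, u \in W.
Proof.
move=> WP W1 W2.
(* [G] is the span of the generators, given as an intersection; it can be shown closed under
   brackets, which W need not be. *)
pose G (u : ext) := forall W : {pred ext}, submod_closed W ->
  (forall a b, ext1 a b \in W) -> (forall b a, ext2 b a \in W) -> u \in W.
suff GT : forall u, G u by move=> u; apply: GT.
have G0 : G 0 by move=> Z [].
have GD a x y : G x -> G y -> G (a *: x + y).
  move=> Gx Gy Z [Z0 ZP] Z1 Z2.
  by apply: (ZP); [apply: Gx => // | apply: Gy => //]; split.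
have G1 a b : G (ext1 a b) by move=> Z _ Z1 _; apply: Z1.
have G2 b a : G (ext2 b a) by move=> Z _ _ Z2; apply: Z2.
have Gind (Q : ext -> Prop) : Q 0 -> (forall a x y, Q x -> Q y -> Q (a *: x + y)) ->
    (forall a b, Q (ext1 a b)) -> (forall b a, Q (ext2 b a)) ->
    forall u, G u -> Q u.
  move=> Q0 QD Q1 Q2 v /(_ [pred x | `[< Q x >]]) H; apply/asboolP/H.
  - split=> [|a x y]; first exact/asboolP.
    by move=> /asboolP Qx /asboolP Qy; apply/asboolP/QD.
  - by move=> a b; apply/asboolP.
  - by move=> b a; apply/asboolP.
have GB u v : G u -> G v -> G {[ u, v ]}.
  move=> Gu; move: u Gu v; apply: (Gind) => [|k x y Gx Gy|a b|b a].
  - by move=> v _; rewrite lbr0l.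
  - by move=> v Gv; rewrite lbr_linearl; apply: GD; [apply: Gx | apply: Gy].
  - apply: (Gind) => [|k x y Gx Gy|a' b'|b' a'].
    + by rewrite lbr0r.
    + by rewrite lbr_linearr; apply: GD.
    + by rewrite -[X in G X](ext_rel (SR_4a a b a' b')); apply: G1.
    + by rewrite -[X in G X](ext_rel (SR_6a a b a' b')); apply: G1.
  apply: (Gind) => [|k x y Gx Gy|a' b'|b' a'].
  - by rewrite lbr0r.
  - by rewrite lbr_linearr; apply: GD.
  - by rewrite -[X in G X](ext_rel (SR_7a a b a' b')); apply: G1.
  - by rewrite -[X in G X](ext_rel (SR_5a a b a' b')); apply: G1.
suff Gepi (x : star A B) : G (epi x).
  move=> u; rewrite -[u]lmod_reprK; exact: Gepi.
have [t <-] : exists t, leib_eval (leib_gen star_rel) t = x.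
  by exists (lmod_repr x); rewrite leib_eval_gen; apply: lmod_reprK.
rewrite (leib_eval_morph _ _ epi_linear epi_br).
elim: t => [[[a b]|[b a]]||s IHs t IHt|a s IHs|s IHs t IHt] /=.
- exact: G1.
- exact: G2.
- by [].
- by rewrite -[leib_eval _ s]scale1r; apply: GD.
- by rewrite -[_ *: _]addr0; apply: GD.
- exact: GB.
Qed.

(* The condition says that [P], as a map on [L (x) L], vanishes on the boundaries
   of the tensors [x (x) y (x) z] with an entry in [A]. *)
Definition rel_cocycle (V : lmodType K) (P : L -> L -> V) : Prop :=
  forall x y z, [|| x \in ideal_pred A, y \in ideal_pred A | z \in ideal_pred A] ->
  P x {[ y, z ]} = P {[ x, y ]} z - P {[ x, z ]} y.

Section Lift.
Variables (V : lmodType K) (P : L -> L -> V).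
Hypotheses (Pl : forall y, linear (P^~ y)) (Pr : forall x, linear (P x)).
Hypothesis (PA : rel_cocycle P).

Let C := ideal_alg (capI A B).
Let w0 (x y : C) := P (ideal_val x) (ideal_val y).

Let w0l y : linear (w0^~ y).
Proof. by move=> a x x'; rewrite /w0 ideal_valD ideal_valZ Pl. Qed.
Let w0r x : linear (w0 x).
Proof. by move=> a y y'; rewrite /w0 ideal_valD ideal_valZ Pr. Qed.
Let w0B x y z : w0 x {[ y, z ]} = w0 {[ x, y ]} z - w0 {[ x, z ]} y.
Proof.
rewrite /w0 !ideal_val_br PA //.
by have /andP[-> _] : ideal_val x \in capI A B by apply: ideal_valP.
Qed.
Let w := Cocycle w0l w0r w0B.

(** The presentation yields homomorphisms only. A linear map is thus obtained as the second
    component of a homomorphism into the central extension of the intersection of A and B by V with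
    cocycle [P], whose first component is theta. *)
Let lift_symb (x : star_symb A B) : cocycle_ext w :=
  (theta_symb x, match x with
                 | inl (a, b) => P (ideal_val a) (ideal_val b)
                 | inr (b, a) => P (ideal_val b) (ideal_val a)
                 end).

Let lift_symb_rel s t : star_rel s t ->
  leib_eval lift_symb s = leib_eval lift_symb t.
Proof.
move=> st; rewrite [LHS]surjective_pairing [RHS]surjective_pairing.
congr (_, _).
  have fstE u : (leib_eval lift_symb u).1 = leib_eval (@theta_symb K L A B) u.
    by rewrite (leib_eval_morph (h := fun p : cocycle_ext w => p.1)).
  by rewrite !fstE (theta_symb_rel st).
have A1 (a : IA) : ideal_val a \in ideal_pred A := ideal_valP a.
have P1 x y z :
    [|| x \in ideal_pred A, y \in ideal_pred A | z \in ideal_pred A] ->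
  P x {[ y, z ]} = P {[ x, y ]} z + (-1) *: P {[ x, z ]} y.
  by move=> h; rewrite PA ?scaleN1r.
have P2 x y z :
    [|| x \in ideal_pred A, y \in ideal_pred A | z \in ideal_pred A] ->
  P {[ x, z ]} y = P {[ x, y ]} z + (-1) *: P x {[ y, z ]}.
  by move=> h; rewrite PA // scaleN1r opprB addrC subrK.
have P3 x y z :
    [|| x \in ideal_pred A, y \in ideal_pred A | z \in ideal_pred A] ->
  P x {[ y, z ]} = (-1) *: P x {[ z, y ]}.
  by move=> h; rewrite !PA ?scaleN1r ?opprB // [X in _ || X]orbC.
(* [P1], [P2] and [P3] are the cocycle condition in the shapes of relations 1, 2 and 3. Relations 4
   to 7 hold by computation, since the bracket of the extension is [P] of the theta components. *)
case: st => [k a a' b|k a b b'|k b b' a|k b a a'|a b b'|b a a'|a a' b|b b' a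
  |a a' b|b b' a||||||||] //.
- exact: Pl.
- exact: Pr.
- exact: Pl.
- exact: Pr.
- by apply: P1; rewrite A1.
- by apply: P1; rewrite A1 orbT.
- by apply: P2; rewrite A1.
- by apply: P2; rewrite A1 orbT.
- by apply: P3; rewrite A1.
- by apply: P3; rewrite A1 !orbT.
Qed.

Let liftP := leib_pres_lift_linear lift_symb_rel.
Let liftB := leib_pres_lift_br lift_symb_rel.

Lemma ext_lift : exists T : {linear ext -> V},
  (forall a b, T (ext1 a b) = P (ideal_val a) (ideal_val b)) /\
  (forall b a, T (ext2 b a) = P (ideal_val b) (ideal_val a)).
Proof.
pose T0 := leib_pres_lift (R := star_rel) lift_symb.
have TI x : x \in genI (@diag_star K L A B) -> T0 x = 0.
  move=> xI; apply/eqP; move: x xI.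
  apply: (genI_min (I := kerI liftP liftB)) => _ [c cA cB c' c'A c'B].
  rewrite inE -scaleN1r addrC liftP scaleN1r addrC subr_eq0; apply/eqP.
  rewrite /star1 /star2 !(leib_pres_liftE lift_symb_rel); congr (_, _).
  exact: ideal_val_inj.
pose T1 := quotI_lift (I := genI (@diag_star K L A B)) T0.
have T1P : linear T1 := quotI_lift_linear liftP TI.
have TP : linear (fun u => (T1 u).2) by move=> a u v; rewrite T1P.
have TE x : (T1 (epi (leib_gen star_rel x))).2 = (lift_symb x).2.
  rewrite /T1 /epi (quotI_liftE liftP TI).
  by rewrite /T0 (leib_pres_liftE lift_symb_rel).
exists (lin_of TP); split=> [a b|b a]; exact: TE.
Qed.
End Lift.
End ExteriorProductTheory.

(** * The exterior product with the whole algebra as a target of 2-chains *)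

Section FullIdeal.
Variables (K : fieldType) (L : leibnizType K) (A : ideal L).
Local Notation IA := (ideal_alg A).
Local Notation ext := (ext A (full_ideal L)).

Definition full (x : L) : ideal_alg (full_ideal L) :=
  @IdealAlg K L (full_ideal L) x isT.

Lemma full_linear : linear full.
Proof. by move=> a x y; apply: ideal_val_inj. Qed.
Lemma full_val b : full (ideal_val b) = b. Proof. exact: ideal_val_inj. Qed.

Variable q : L -> IA.
Hypotheses (qP : linear q) (qA : forall a, q (ideal_val a) = a).

(* As [x (x) y = q x (x) y + (x - q x) (x) q y] for [x (x) y] with an entry in [A],
   this is the only possible linear extension of [ext1] and [ext2]. *)
Definition ext_of (x y : L) : ext :=
  ext1 (q x) (full y) + ext2 (full (x - ideal_val (q x))) (q y).

Lemma ext_ofl y : linear (ext_of^~ y).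
Proof.
move=> a x x'; rewrite /ext_of qP ext1_linearl.
have -> : a *: x + x' - ideal_val (a *: q x + q x') =
    a *: (x - ideal_val (q x)) + (x' - ideal_val (q x')).
  by rewrite ideal_valD ideal_valZ scalerBr opprD addrACA.
by rewrite full_linear ext2_linearl scalerDr addrACA.
Qed.

Lemma ext_ofr x : linear (ext_of x).
Proof.
move=> a y y'; rewrite /ext_of qP full_linear ext1_linearr ext2_linearr.
by rewrite scalerDr addrACA.
Qed.

Lemma ext_of1 a y : ext_of (ideal_val a) y = ext1 a (full y).
Proof.
rewrite /ext_of qA subrr (linear_on0 full_linear).
by rewrite (linear_on0 (@ext2_linearl _ _ _ _ _)) addr0.
Qed.

(** The component q x of x and the element a both lie in A, so the relation that distinguishes the
    exterior from the tensor product turns the [ext1] term into an [ext2] term. *)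
Lemma ext_of2 x a : ext_of x (ideal_val a) = ext2 (full x) a.
Proof.
rewrite /ext_of qA.
have -> : ext1 (q x) (full (ideal_val a)) = ext2 (full (ideal_val (q x))) a :> ext.
  case: (q x) (a) => [c cA] [c' c'A].
  exact: (@ext_diag _ _ A (full_ideal L) c cA isT c' c'A isT).
rewrite -(linear_on_add (@ext2_linearl _ _ _ _ a)) -(linear_on_add full_linear).
by rewrite addrC subrK.
Qed.

(** For x in A this is [SR_1a], for y in A it is [SR_2b], and [SR_3b] reduces z in A to the case of
    y. *)
Lemma ext_of_cocycle : rel_cocycle A ext_of.
Proof.
have R2 x (a : IA) z : ext_of x {[ ideal_val a, z ]} =
    ext_of {[ x, ideal_val a ]} z - ext_of {[ x, z ]} (ideal_val a).
  have := ext_rel (SR_2b (full x) (full z) a) => /= E.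
  rewrite -[{[ _, z ]}]/(ideal_val (ract a z)) ext_of2.
  rewrite -[{[ x, _ ]}]/(ideal_val (lact x a)) ext_of1 ext_of2.
  have -> : full {[ x, z ]} = {[ full x, full z ]} by apply: ideal_val_inj.
  have {}E : ext2 {[ full x, full z ]} a = ext1 (lact x a) (full z) +
    (-1) *: ext2 (full x) (ract a z) :> ext by exact: E.
  by rewrite E scaleN1r opprB addrC subrK.
move=> x y z /or3P [xA|yA|zA].
- pose a := IdealAlg xA.
  rewrite -[x]/(ideal_val a) -[{[ _, y ]}]/(ideal_val (ract a y)).
  rewrite -[{[ _, z ]} in X in _ - X]/(ideal_val (ract a z)) !ext_of1.
  have -> : full {[ y, z ]} = {[ full y, full z ]} by apply: ideal_val_inj.
  by rewrite -scaleN1r; exact: (ext_rel (SR_1a a (full y) (full z))).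
- exact: (R2 x (IdealAlg yA) z).
pose a := IdealAlg zA; rewrite -[z]/(ideal_val a).
have -> : ext_of x {[ y, ideal_val a ]} = - ext_of x {[ ideal_val a, y ]}.
  rewrite -[{[ y, _ ]}]/(ideal_val (lact y a)) -[{[ _, y ]}]/(ideal_val (ract a y)).
  by rewrite !ext_of2 -scaleN1r; exact: (ext_rel (SR_3b (full x) (full y) a)).
by rewrite R2 opprB.
Qed.

End FullIdeal.

(** * Tensors of degree at most 3 *)

Section SmallTensors.
Variables (K : fieldType) (L : leibnizType K).

Definition tens0 : CL L 0 := tens [ffun=> 0].
Definition tens1 (x : L) : CL L 1 := snoc tens0 x.
Definition tens2 x y : CL L 2 := snoc (tens1 x) y.
Definition tens3 x y z : CL L 3 := snoc (tens2 x y) z.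

Lemma tens1E (x : {ffun 'I_1 -> L}) : tens x = tens1 (x ord0).
Proof.
have -> : ord0 = ord_max :> 'I_1 by apply: val_inj.
rewrite -[x in LHS]rconsf_initf -snoc_tens; congr (snoc (tens _) _).
by apply/ffunP => -[].
Qed.
Lemma tens2E (x : {ffun 'I_2 -> L}) : tens x = tens2 (x ord0) (x ord_max).
Proof.
rewrite -[x in LHS]rconsf_initf -snoc_tens tens1E ffunE.
by congr (snoc (tens1 (x _)) _); apply: val_inj.
Qed.

Lemma CL_ext1 (V : lmodType K) (f g : CL L 1 -> V) : linear f -> linear g ->
  (forall x, f (tens1 x) = g (tens1 x)) -> f =1 g.
Proof. by move=> fP gP fg; apply: CL_ext => // x; rewrite tens1E. Qed.
Lemma CL_ext2 (V : lmodType K) (f g : CL L 2 -> V) : linear f -> linear g ->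
  (forall x y, f (tens2 x y) = g (tens2 x y)) -> f =1 g.
Proof. by move=> fP gP fg; apply: CL_ext => // x; rewrite tens2E. Qed.
Lemma CL_ext3 (V : lmodType K) (f g : CL L 3 -> V) : linear f -> linear g ->
  (forall x y z, f (tens3 x y z) = g (tens3 x y z)) -> f =1 g.
Proof.
move=> fP gP fg; apply: CL_extS => // m z; move: m.
apply: CL_ext2 => [a m m'|a m m'|x y]; last exact: fg.
  by rewrite snoc_linearl fP.
by rewrite snoc_linearl gP.
Qed.

Lemma bnd_tens2 x y : bnd (tens2 x y) = tens1 {[ x, y ]}.
Proof.
rewrite /tens2 bnd_snoc bnd1 snoc0l add0r expr0 scale1r act_snoc.
by rewrite [act tens0 _]/(0) snoc0l add0r.
Qed.

Lemma bnd_tens3 x y z : bnd (tens3 x y z) =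
  tens2 {[ x, y ]} z - tens2 {[ x, z ]} y - tens2 x {[ y, z ]}.
Proof.
rewrite /tens3 bnd_snoc bnd_tens2 expr1 scaleN1r /tens2 act_snoc act_snoc.
by rewrite [act tens0 _]/(0) snoc0l add0r opprD addrA.
Qed.

Section Lifts.
Variable V : lmodType K.

Lemma CL_lift1 (P : L -> V) : linear P ->
  exists F : {linear CL L 1 -> V}, forall x, F (tens1 x) = P x.
Proof.
move=> PP; pose j (x : {ffun 'I_1 -> L}) := P (x ord0).
have jR s t : @tensor_rel K L 1 s t -> lmod_eval j s = lmod_eval j t.
  by case=> x p a u v; rewrite (ord1 p) /= /j !ffunE eqxx PP.
exists (lin_of (lmod_pres_lift_linear jR)) => x.
rewrite lin_ofE -[x in LHS](ffunE (fun _ : 'I_1 => x) ord0) -tens1E.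
by rewrite (lmod_pres_liftE jR) /j ffunE.
Qed.

Lemma CL_lift2 (P : L -> L -> V) :
  (forall y, linear (P^~ y)) -> (forall x, linear (P x)) ->
  exists F : {linear CL L 2 -> V}, forall x y, F (tens2 x y) = P x y.
Proof.
move=> Pl Pr; pose j (x : {ffun 'I_2 -> L}) := P (x ord0) (x ord_max).
have jR s t : @tensor_rel K L 2 s t -> lmod_eval j s = lmod_eval j t.
  case=> x p a u v; rewrite /= /j !ffunE.
  have [->|->] : p = ord0 \/ p = ord_max.
    by case: p => -[|[|//]] lt; [left|right]; apply: val_inj.
  - by rewrite /= Pl.
  - by rewrite /= Pr.
exists (lin_of (lmod_pres_lift_linear jR)) => x y.
pose t := [ffun k : 'I_2 => if k == ord0 then x else y].
have [tx ty] : t ord0 = x /\ t ord_max = y by rewrite !ffunE.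
by rewrite lin_ofE -[in LHS]tx -[in LHS]ty -tens2E (lmod_pres_liftE jR) /j tx ty.
Qed.

End Lifts.
End SmallTensors.

Section SmallMaps.
Variables (K : fieldType) (L M : leibnizType K) (phi : {linear L -> M}).

Lemma CL_map0 : CL_map phi (tens0 L) = tens0 M.
Proof.
rewrite [CL_map _ _](lmod_pres_liftE (j := fun _ => tens0 M)) //.
by move=> s t [x' []].
Qed.
Lemma CL_map2 x y : CL_map phi (tens2 x y) = tens2 (phi x) (phi y).
Proof. by rewrite /tens2 /tens1 !CL_map_snoc CL_map0. Qed.
Lemma CL_map3 x y z : CL_map phi (tens3 x y z) = tens3 (phi x) (phi y) (phi z).
Proof. by rewrite /tens3 CL_map_snoc CL_map2. Qed.

End SmallMaps.

(** * The kernel of the map induced on tensor powers by a split surjection *)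

Section RelativeChains.
Variables (K : fieldType) (L M : leibnizType K).
Variables (phi : {linear L -> M}) (s : {linear M -> L}).
Hypothesis phiK : cancel s phi.

Lemma CL_mapK n : cancel (@CL_map K M L s n) (CL_map phi (n := n)).
Proof.
elim: n => [|n IH].
  apply: CL_ext => [a m m'|//|x]; first by rewrite !linearP.
  have -> : tens x = tens0 M by congr tens; apply/ffunP => -[].
  by rewrite !CL_map0.
apply: CL_extS => [a m m'|//|m x]; first by rewrite !linearP.
by rewrite !CL_map_snoc IH phiK.
Qed.

Variable V : lmodType K.

Let split_phi x : exists2 u, phi u = 0 & x = u + s (phi x).
Proof. by exists (x - s (phi x)); rewrite ?subrK // linearB /= phiK subrr. Qed.

(** Split each entry x as u + s (phi x) with u in the kernel of phi. All terms of the expansion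
    except s (phi x) (x) s (phi y) have an entry in that kernel, so F factors through the chain map
    of phi. *)
Lemma rel_chain2 (F : {linear CL L 2 -> V}) :
    (forall x y, (phi x == 0) || (phi y == 0) -> F (tens2 x y) = 0) ->
  forall c, CL_map phi c = 0 -> F c = 0.
Proof.
move=> F0 c c0; suff -> : F c = F (CL_map s (CL_map phi c)) by rewrite c0 !linear0.
move: c {c0}; apply: CL_ext2 => [a m m'|a m m'|x y]; rewrite ?linearP //.
rewrite !CL_map2; have [u u0 xE] := split_phi x; have [v v0 yE] := split_phi y.
rewrite {1}xE {1}yE /tens2 /tens1 !(snocDl, snocDr).
rewrite -![snoc (snoc _ _) _]/(tens2 _ _) !linearD /=.
by rewrite !(F0 u) ?(F0 _ v) ?u0 ?v0 ?eqxx ?orbT ?add0r.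
Qed.

Lemma rel_chain3 (F : {linear CL L 3 -> V}) :
    (forall x y z, [|| phi x == 0, phi y == 0 | phi z == 0] ->
       F (tens3 x y z) = 0) ->
  forall c, CL_map phi c = 0 -> F c = 0.
Proof.
move=> F0 c c0; suff -> : F c = F (CL_map s (CL_map phi c)) by rewrite c0 !linear0.
move: c {c0}; apply: CL_ext3 => [a m m'|a m m'|x y z]; rewrite ?linearP //.
rewrite !CL_map3; have [u u0 xE] := split_phi x; have [v v0 yE] := split_phi y.
have [w w0 zE] := split_phi z; rewrite {1}xE {1}yE {1}zE.
rewrite /tens3 /tens2 /tens1 !(snocDl, snocDr).
rewrite -![snoc (snoc (snoc _ _) _) _]/(tens3 _ _ _) !linearD /=.
by rewrite !(F0 u) ?(F0 _ v) ?(F0 _ _ w) ?u0 ?v0 ?w0 ?eqxx ?orbT ?add0r.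
Qed.

End RelativeChains.

(** * Kernels, and chains modulo boundaries *)

Section KernelTheory.
Variables (K : fieldType) (U V : lmodType K) (h : {linear U -> V}).

Lemma ker_val_linear : linear (@ker_val K U V h).
Proof. by move=> a x y; exact: (linearP \val). Qed.
Lemma ker_valB x y : @ker_val K U V h (x - y) = ker_val x - ker_val y.
Proof. exact: (raddfB \val). Qed.
Lemma ker_val_inj : injective (@ker_val K U V h).
Proof. exact: val_inj. Qed.
Lemma ker_valE x (xP : x \in ker_pred h) : ker_val (Ker xP) = x.
Proof. by []. Qed.

End KernelTheory.

Section BoundaryQuotient.
Variables (K : fieldType) (L : leibnizType K) (n : nat).

Definition im_bnd : {pred CL L n} :=
  [pred z | `[< exists y : CL L n.+1, bnd y = z >]].
Lemma im_bnd_submod : submod_closed im_bnd.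
Proof.
split=> [|a x y]; first by apply/asboolP; exists 0; rewrite linear0.
move=> /asboolP [x' <-] /asboolP [y' <-]; apply/asboolP.
by exists (a *: x' + y'); rewrite linearP.
Qed.
HB.instance Definition _ :=
  GRing.isSubmodClosed.Build K (CL L n) im_bnd im_bnd_submod.

(** Classes of all chains, not only of cycles: the map that inverts the isomorphism is first defined
    on the whole exterior product, where the chains involved need not be cycles. *)
Definition mod_bnd : CL L n -> quot im_bnd := @quot_pi K (CL L n) im_bnd.
Lemma mod_bnd_linear : linear mod_bnd.
Proof.
move=> a x y; rewrite -[a *: mod_bnd x](lmod_piZ (P := quot_premod _)).
by rewrite -[RHS](lmod_piD (P := quot_premod _)).
Qed.
Lemma mod_bnd_eq0 z : mod_bnd z = 0 <-> exists y : CL L n.+1, bnd y = z.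
Proof.
split=> [z0|[y yz]].
  suff : z - 0 \in im_bnd by rewrite subr0 => /asboolP.
  by apply/(lmod_piP (P := quot_premod _)).
apply/(lmod_piP (P := quot_premod _)); rewrite /= /eqmodW subr0.
by apply/asboolP; exists y.
Qed.

End BoundaryQuotient.

(** * Linear splitting of the presentation and relative cocycles *)

Section FreePresentation.
Variables (K : fieldType) (r f g : leibnizType K).
Variables (iota : {leibniz r -> f}) (pi : {leibniz f -> g}).
Hypothesis ses : short_exact iota pi.

Local Notation A := (imI ses).

Let memA x : (x \in ideal_pred A) = (pi x == 0).
Proof. exact: imI_predE. Qed.

(** The section sends z to x - q0 x for any preimage x of z; the choice does not matter because q0
    fixes the kernel of pi. *)
Lemma linear_splitting : exists (q : f -> ideal_alg A) (s : {linear g -> f}),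
  [/\ linear q, forall a, q (ideal_val a) = a & cancel s pi].
Proof.
have [q0 [q0P q0A q0K]] := linear_retraction (ideal_submod A).
pose q x := IdealAlg (q0A x).
have [_ _ pi_surj] := ses.
pose s z := let x := projT1 (cid (pi_surj z)) in x - q0 x.
have sE x : s (pi x) = x - q0 x.
  rewrite /s; case: (cid _) => y /= /eqP; rewrite -subr_eq0 -linearB => pixy.
  have := q0K (y - x); rewrite memA => /(_ pixy).
  rewrite [q0 _](raddfB (lin_of q0P)) => e.
  by apply/eqP; rewrite subr_eq -addrA [- _ + _]addrC e addrC subrK.
have sP : linear s.
  move=> a z w; have [x <-] := pi_surj z; have [y <-] := pi_surj w.
  by rewrite -linearP !sE q0P scalerBr opprD addrACA.
exists q, (lin_of sP); split=> [a x y|a|z].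
- by apply: ideal_val_inj; rewrite ideal_valD ideal_valZ; exact: q0P.
- by apply: ideal_val_inj; apply: q0K; apply: ideal_valP.
rewrite lin_ofE; have [x <-] := pi_surj z; rewrite sE linearB /=.
by have /eqP -> : pi (q0 x) == 0; [rewrite -memA | rewrite subr0].
Qed.

(** The condition on the right is the one on the left for the tensors with an entry in r, which
    suffice by [rel_chain3]. *)
Lemma rel_cocycleP (s : {linear g -> f}) (sK : cancel s pi)
    (V : lmodType K) (F : {linear CL f 2 -> V}) :
  (forall c : CL f 3, CL_map pi c = 0 -> F (bnd c) = 0) <->
  rel_cocycle A (fun x y => F (tens2 x y)).
Proof.
have FE x y z : F (bnd (tens3 x y z)) = F (tens2 {[ x, y ]} z) -
    F (tens2 {[ x, z ]} y) - F (tens2 x {[ y, z ]}).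
  by rewrite bnd_tens3 !linearB.
split=> [F0 x y z|PA c].
  rewrite !memA => xyz; apply/eqP; rewrite eq_sym -subr_eq0 -FE; apply/eqP/F0.
  rewrite CL_map3 /= /tens3 /tens2 /tens1.
  by case/or3P: xyz => /eqP ->; rewrite !(snoc0r, snoc0l).
have FP : linear (fun c : CL f 3 => F (bnd c)) by move=> a x y; rewrite !linearP.
apply: (rel_chain3 sK (F := lin_of FP)) => x y z; rewrite -!memA lin_ofE => xyz.
by rewrite FE PA // subrr.
Qed.

End FreePresentation.

(** * The connecting map and its inverse *)

Theorem theorem4p2 (K : fieldType) (r f g : leibnizType K)
    (iota : {leibniz r -> f}) (pi : {leibniz f -> g})
    (X : Type) (i : X -> f) (f_free : free_leibniz i)
    (ses : short_exact iota pi) :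
  exists phi : {linear HL g 3 -> ker (theta (imI ses) (full_ideal f))},
    bijective phi.
Proof.
set A := imI ses.
have memA x : (x \in ideal_pred A) = (pi x == 0) := imI_predE ses x.
have [q [s [qP qA sK]]] := linear_splitting ses.
have [h hE] := free_contraction f_free.
(* [E2] induces the isomorphism of [K_2 / d K_3] onto the exterior product. *)
have [E2 E2E] := CL_lift2 (ext_ofl qP) (ext_ofr qP).
have E2_bnd (c : CL f 3) : CL_map pi c = 0 -> E2 (bnd c) = 0.
  apply: (rel_cocycleP ses sK E2).2 => x y z xyz; rewrite !E2E.
  exact: ext_of_cocycle.
(* [v1] identifies CL_1 with f, so that theta can be compared with the differential. *)
have [v1 v1E] := @CL_lift1 K f f id (fun _ _ _ => erefl).
have v1K : cancel v1 (@tens1 K f).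
  apply: CL_ext1 => [a x y||x]; rewrite ?v1E //.
  by rewrite linearP /tens1 snoc_linearr.
have theta_E2 k : CL_map pi k = 0 ->
    ideal_val (theta A (full_ideal f) (E2 k)) = v1 (bnd k).
  move=> k0; apply/eqP; rewrite -subr_eq0; apply/eqP; move: k k0.
  have FP : linear (fun k => ideal_val (theta A (full_ideal f) (E2 k)) - v1 (bnd k)).
    move=> a x y; rewrite !linearP ideal_valD ideal_valZ scalerBr.
    by rewrite /= scalerN addrACA.
  apply: (rel_chain2 sK (F := lin_of FP)) => x y; rewrite -!memA lin_ofE => xy.
  apply/eqP; rewrite subr_eq0 bnd_tens2 v1E E2E; apply/eqP.
  case/orP: xy => [xA|yA].
    by rewrite -[x]/(ideal_val (IdealAlg xA)) ext_of1 // thetaE1.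
  by rewrite -[y]/(ideal_val (IdealAlg yA)) ext_of2 // thetaE2.
have E2_surj u : exists2 k, CL_map pi k = 0 & E2 k = u.
  pose W : {pred ext A (full_ideal f)} :=
    [pred u | `[< exists2 k, CL_map pi k = 0 & E2 k = u >]].
  suff : u \in W by move/asboolP.
  move: u; apply: ext_ind => [|a b|b a].
  - split=> [|a x y].
      by apply/asboolP; exists 0; rewrite linear0.
    move=> /asboolP [k k0 <-] /asboolP [k' k'0 <-]; apply/asboolP.
    by exists (a *: k + k'); rewrite linearP //= k0 k'0 scaler0 addr0.
  - have := ideal_valP a; rewrite memA => /eqP a0; apply/asboolP.
    exists (tens2 (ideal_val a) (ideal_val b)).
      by rewrite CL_map2 /= a0 /tens2 /tens1 snoc0r snoc0l.
    by rewrite E2E ext_of1 // full_val.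
  have := ideal_valP a; rewrite memA => /eqP a0; apply/asboolP.
  exists (tens2 (ideal_val b) (ideal_val a)).
    by rewrite CL_map2 /= a0 /tens2 snoc0r.
  by rewrite E2E ext_of2 // full_val.
have mapK n : cancel (@CL_map K g f s n) (CL_map pi (n := n)) := CL_mapK sK (n := n).
(* The chain c - s (pi c) is killed by pi, so [E2_bnd] applies to it. *)
have E2_bnd_eq (c : CL f 3) : E2 (bnd c) = E2 (bnd (CL_map s (CL_map pi c))).
  have := E2_bnd (c - CL_map s (CL_map pi c)).
  by rewrite !linearB /= mapK subrr => /(_ erefl) /eqP; rewrite subr_eq0 => /eqP.
(* The connecting homomorphism: lift z along s and take the boundary. As s is only linear, the lift
   of a cycle need not be a cycle. *)
pose psi0 (z : CL g 3) := E2 (bnd (CL_map s z)).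
have psi0P : linear psi0 by move=> a x y; rewrite /psi0 !linearP.
have psi0_ker (z : cycles g 3) :
    psi0 (ker_val z) \in ker_pred (theta A (full_ideal f)).
  apply/eqP/ideal_val_inj; rewrite theta_E2.
    by rewrite (bnd_bnd (CL_map s (ker_val z))) linear0 ideal_val0.
  rewrite (CL_map_bnd pi (CL_map s (ker_val z))) mapK; apply/eqP; exact: valP z.
pose psi z := Ker (psi0_ker z).
have psiP : linear psi.
  move=> a x y; apply: ker_val_inj; rewrite ker_val_linear.
  by rewrite -[LHS]/(psi0 (ker_val (a *: x + y))) ker_val_linear psi0P.
(* If z - z' is the boundary of y, then d (s y) is another lift of it, and its boundary is zero; by
   [E2_bnd_eq] the choice of lift is immaterial. *)
have psi_eq (z z' : cycles g 3) :
    pl_eqv (p := quot_premod (@boundaries K g 3)) z z' -> psi z = psi z'.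
  rewrite /= /eqmodW => /asboolP [y]; rewrite ker_valB => yE.
  apply: ker_val_inj; rewrite -[LHS]/(psi0 (ker_val z)) -[RHS]/(psi0 (ker_val z')).
  apply/eqP; rewrite -subr_eq0 -[_ - _](raddfB (lin_of psi0P)) -yE /= /psi0.
  by rewrite -{1}[y]mapK -(CL_map_bnd pi) -E2_bnd_eq (bnd_bnd (CL_map s y)) linear0.
pose Q := quot_premod (@boundaries K g 3).
have phiP : linear (lmod_lift (P := Q) psi).
  exact: (lmod_lift_linear (P := Q) psi_eq (linear_on_add psiP)
    (linear_on_scale psiP)).
pose phi : {linear HL g 3 -> ker (theta A (full_ideal f))} := lin_of phiP.
have phiE z : phi (lmod_pi (P := Q) z) = psi z.
  exact: (lmod_liftE (P := Q) psi_eq).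
have phi_surj u : exists z, phi z = u.
  have [k k0 kE] := E2_surj (ker_val u).
  have bk0 : bnd k = 0.
    rewrite -[bnd k]v1K -theta_E2 // kE.
    by have /eqP -> := valP u; rewrite ideal_val0 /tens1 snoc0r.
  (* This is the vanishing of HL_2 f; the image of h k under pi is then the required cycle. *)
  have hk : bnd (h 1 k) = k.
    by have := hE 0 k; rewrite bk0 linear0 addr0.
  have zP : CL_map pi (h 1 k) \in ker_pred (@bnd K g 3).
    by apply/eqP; rewrite -[LHS](CL_map_bnd pi (h 1 k)) hk.
  exists (lmod_pi (P := Q) (Ker zP)); rewrite phiE.
  by apply: ker_val_inj; rewrite ker_valE /psi0 ker_valE -E2_bnd_eq hk.
(* [T], which sends [E2 k] to the class of [pi (h k)], is inverse to [psi]. *)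
pose P x y := mod_bnd (CL_map pi (h 1 (tens2 x y))).
have GP : linear (fun k => mod_bnd (CL_map pi (h 1 k))).
  by move=> a x y; rewrite !linearP mod_bnd_linear.
have GA : rel_cocycle A P.
  apply: (rel_cocycleP ses sK (lin_of GP)).1 => c c0; rewrite lin_ofE.
  (* Applying pi to d (h c) + h (d c) = c, where pi c = 0, exhibits pi (h (d c)) as a boundary. *)
  have /(congr1 (CL_map pi (n := 3))) := hE 1 c.
  rewrite linearD /= c0 (CL_map_bnd pi (h 2 c)) => /eqP.
  rewrite addrC addr_eq0 => /eqP ->.
  by apply/mod_bnd_eq0; exists (- CL_map pi (h 2 c)); rewrite linearN.
have Pl y : linear (P^~ y).
  by move=> a x x'; rewrite /P /tens2 /tens1 snoc_linearr snoc_linearl -GP.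
have Pr x : linear (P x).
  by move=> a y y'; rewrite /P /tens2 snoc_linearr -GP.
have [T [T1 T2]] := ext_lift (full_ideal f) Pl Pr GA.
have T_E2 k : CL_map pi k = 0 -> T (E2 k) = mod_bnd (CL_map pi (h 1 k)).
  move=> k0; apply/eqP; rewrite -subr_eq0; apply/eqP; move: k k0.
  have FP : linear (fun k => T (E2 k) - mod_bnd (CL_map pi (h 1 k))).
    by move=> a x y; rewrite !linearP mod_bnd_linear opprD scalerBr addrACA.
  apply: (rel_chain2 sK (F := lin_of FP)) => x y; rewrite -!memA lin_ofE => xy.
  apply/eqP; rewrite subr_eq0 -/(P x y) E2E; apply/eqP.
  case/orP: xy => [xA|yA].
    by rewrite -[x]/(ideal_val (IdealAlg xA)) ext_of1 // T1.
  by rewrite -[y]/(ideal_val (IdealAlg yA)) ext_of2 // T2.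
have phi_inj u : phi u = 0 -> u = 0.
  rewrite -[u]lmod_reprK phiE; move: (lmod_repr u) => {u} z.
  move=> /(congr1 (@ker_val _ _ _ _)); rewrite ker_valE /psi0 => Ez0.
  have z0 : bnd (ker_val z) = 0 by exact/eqP/(valP z).
  (* Applying [T] shows that pi (h (d (s z))) is a boundary; the image under pi of the homotopy
     identity for s z then makes z a boundary. *)
  have := T_E2 (bnd (CL_map s (ker_val z))).
  rewrite (CL_map_bnd pi (CL_map s (ker_val z))) mapK z0 => /(_ erefl).
  rewrite [E2 _]Ez0 linear0 => /esym/mod_bnd_eq0 [y yE].
  apply/(lmod_piP (P := quot_premod _)); rewrite /= /eqmodW subr0.
  apply/asboolP; have /(congr1 (CL_map pi (n := 3))) := hE 1 (CL_map s (ker_val z)).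
  rewrite linearD /= mapK (CL_map_bnd pi (h 2 (CL_map s (ker_val z)))) -yE => <-.
  by exists (CL_map pi (h 2 (CL_map s (ker_val z))) + y); rewrite linearD.
exists phi.
pose inv u := projT1 (cid (phi_surj u)).
have invK : cancel inv phi by move=> u; exact: projT2 (cid (phi_surj u)).
exists inv => // u; apply/eqP; rewrite -subr_eq0; apply/eqP/phi_inj.
by rewrite linearB invK subrr.
Qed.
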